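(* Let $VA[\Gamma]$ be a spherical virtual Artin group. Let $w=\big(\prod_{\beta\in\Phi[\Gamma]}\overline{\zeta}_\beta^{\,a_\beta}\big)\theta$ be an element of $VA[\Gamma]/PVA[\Gamma]'$, where $a_\beta\in\mathbb{Z}$ and $\theta\in W[\Gamma]$, and let $T_\theta$ be a set of representatives of the orbits of the action of $w$ on the set $\{\zeta_\beta\mid\beta\in\Phi[\Gamma]\}$. Then $w$ has order $t$ if and only if $\theta$ has order $t$ and $\sum_{\zeta_\beta\in\mathcal{O}_\theta(\zeta_\gamma)}a_\beta=0$ for all $\zeta_\gamma\in T_\theta$.
   Context: Coxeter data. A Coxeter matrix on a finite set $S$ is a symmetric matrix $(m_{s,t})_{s,t\in S}$ with entries in $\mathbb{N}\cup\{\infty\}$, $m_{s,s}=1$, and $m_{s,t}=m_{t,s}\ge 2$ for $s\ne t$. It is encoded by its Coxeter graph $\Gamma$ (vertex set $S$; edge $\{s,t\}$ iff $m_{s,t}\ge 3$, labelled by $m_{s,t}$ if $m_{s,t}\ge4$). For group elements $x,y$ and $m\ge1$, $\mathrm{Prod}_R(x,y,m)$ denotes the alternating word $\cdots yxy$ of length $m$ (rightmost letter $y$). The Coxeter group $W[\Gamma]$ is generated by $S$ with relations $s^2=1$ for all $s\in S$ and $\mathrm{Prod}_R(t,s,m_{s,t})=\mathrm{Prod}_R(s,t,m_{s,t})$ for $s\neq t$ with $m_{s,t}<\infty$. $VA[\Gamma]$ is called spherical if $W[\Gamma]$ is finite. Virtual Artin group. $VA[\Gamma]$ is the group generated by $\{\sigma_s\mid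 s\in S\}\sqcup\{\tau_s\mid s\in S\}$ with relations: (1) $\mathrm{Prod}_R(\sigma_t,\sigma_s,m_{s,t})=\mathrm{Prod}_R(\sigma_s,\sigma_t,m_{s,t})$ for $s\ne t$, $m_{s,t}<\infty$; (2) $\mathrm{Prod}_R(\tau_t,\tau_s,m_{s,t})=\mathrm{Prod}_R(\tau_s,\tau_t,m_{s,t})$ for $s\neq t$, $m_{s,t}<\infty$, and $\tau_s^2=1$ for $s\in S$; (3) $\mathrm{Prod}_R(\tau_s,\tau_t,m_{s,t}-1)\,\sigma_s=\sigma_r\,\mathrm{Prod}_R(\tau_s,\tau_t,m_{s,t}-1)$ for $s\ne t$, $m_{s,t}<\infty$, where $r=s$ if $m_{s,t}$ is even and $r=t$ if $m_{s,t}$ is odd. $PVA[\Gamma]$ is the kernel of $\pi_P: VA[\Gamma]\to W[\Gamma]$, $\pi_P(\sigma_s)=\pi_P(\tau_s)=s$, and $PVA[\Gamma]'$ is its commutator subgroup. The map $\pi_P$ has the section $\iota_W:W[\Gamma]\to VA[\Gamma]$, $\iota_W(s)=\tau_s$, so $VA[\Gamma]/PVA[\Gamma]'\cong (PVA[\Gamma]/PVA[\Gamma]')\rtimes W[\Gamma]$, and $\theta\in W[\Gamma]$ is identified with the class of $\iota_W(\theta)$ in this quotient. Root system. Let $V$ be the real vector space with basis $\{\alpha_s\mid s\in S\}$ and symmetric bilinear form $\langle\alpha_s,\alpha_t\rangle=-2\cos(\pi/m_{s,t})$ if $m_{s,t}<\infty$ and $-2$ if $m_{s,t}=\infty$. The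 Tits representation $\rho: W[\Gamma]\to \mathrm{GL}(V)$ is $\rho(s)(v)=v-\langle v,\alpha_s\rangle\alpha_s$, and $\Phi[\Gamma]=\{\rho(w)(\alpha_s)\mid s\in S, w\in W[\Gamma]\}$. The elements $\zeta_\beta$. For $\beta=\rho(w)(\alpha_s)\in\Phi[\Gamma]$, $\zeta_\beta:=\iota_W(w)\,\tau_s\sigma_s\,\iota_W(w)^{-1}\in PVA[\Gamma]$ (independent of the choice of $w,s$), and $\overline{\zeta}_\beta$ is its image in $PVA[\Gamma]/PVA[\Gamma]'$. The group $PVA[\Gamma]/PVA[\Gamma]'$ is free abelian with basis $\{\overline{\zeta}_\beta\mid \beta\in\Phi[\Gamma]\}$, so every element of $VA[\Gamma]/PVA[\Gamma]'$ is uniquely of the form $\big(\prod_{\beta}\overline{\zeta}_\beta^{\,a_\beta}\big)\theta$ with $a_\beta\in\mathbb{Z}$, $\theta\in W[\Gamma]$. Such an element $w$ acts on $\{\zeta_\beta\mid\beta\in\Phi[\Gamma]\}$ by $w\cdot\zeta_\beta=\theta\cdot\zeta_\beta=\zeta_{\rho(\theta)(\beta)}$; orbits are those of the cyclic group generated by this permutation, $\mathcal{O}_\theta(\zeta_\beta)$ denotes the orbit of $\zeta_\beta$, and $T_\theta$ a set of orbit representatives. *)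

(* Defs.v *)
From HB Require Import structures.
From mathcomp Require Import all_boot all_order all_algebra.
From mathcomp Require Import all_classical all_reals all_analysis.
From mathcomp Require Import finmap ring.

Set Implicit Arguments.
Unset Strict Implicit.
Unset Printing Implicit Defensive.

Import Order.TTheory GRing.Theory Num.Theory.

Local Open Scope quotient_scope.
Local Open Scope classical_set_scope.
Local Open Scope group_scope.

Definition expgz (G : groupType) (x : G) (n : int) : G :=
  match n with Posz k => x ^+ k | Negz k => x ^- k.+1 end.

Definition has_order (G : groupType) (x : G) (t : nat) : Prop :=
  [/\ (0 < t)%N, x ^+ t = 1 &
      forall k : nat, (0 < k)%N -> x ^+ k = 1 -> (t <= k)%N].

(* A letter (x, false) stands for x, and (x, true) for its inverse. *)
Definition word (X : choiceType) : Type := seq (X * bool).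
HB.instance Definition _ (X : choiceType) := Choice.on (word X).

Definition positive_word (X : choiceType) (u : seq X) : word X :=
  [seq (x, false) | x <- u].

Definition word_inv (X : choiceType) (u : word X) : word X :=
  rev [seq (l.1, ~~ l.2) | l <- u].

(* All the presentations below have relations between positive words: rel u v
   is read as the relation u = v. *)
Inductive pres_cong (X : choiceType) (rel : seq X -> seq X -> Prop) :
    word X -> word X -> Prop :=
| PresRefl u : pres_cong rel u u
| PresSym u v : pres_cong rel u v -> pres_cong rel v u
| PresTrans u v w : pres_cong rel u v -> pres_cong rel v w -> pres_cong rel u w
| PresCat u u' v v' :
    pres_cong rel u u' -> pres_cong rel v v' ->
    pres_cong rel (u ++ v) (u' ++ v')
| PresCancel x b : pres_cong rel [:: (x, b); (x, ~~ b)] [::]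
| PresRel u v : rel u v -> pres_cong rel (positive_word u) (positive_word v).

Section Presentation.
Variables (X : choiceType) (rel : seq X -> seq X -> Prop).

Definition pres_eq (u v : word X) : bool := `[< pres_cong rel u v >].

Fact pres_eq_refl : reflexive pres_eq.
Proof. by move=> u; apply/asboolP/PresRefl. Qed.

Fact pres_eq_sym : symmetric pres_eq.
Proof. by move=> u v; apply/asboolP/asboolP => /PresSym. Qed.

Fact pres_eq_trans : transitive pres_eq.
Proof.
by move=> v u w /asboolP uv /asboolP vw; apply/asboolP; apply: PresTrans uv vw.
Qed.

Canonical pres_equiv := EquivRel pres_eq pres_eq_refl pres_eq_sym pres_eq_trans.

Definition presented : Type := {eq_quot pres_equiv}.
HB.instance Definition _ := Choice.on presented.

Definition pres_class (u : word X) : presented := \pi_({eq_quot pres_equiv}) u.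
Definition pres_repr (x : presented) : word X :=
  repr (x : {eq_quot pres_equiv}).
Definition pres_gen (x : X) : presented := pres_class [:: (x, false)].

Lemma pres_reprK x : pres_class (pres_repr x) = x.
Proof. exact: reprK. Qed.

Lemma pres_classP u v : pres_class u = pres_class v <-> pres_cong rel u v.
Proof.
by split=> [/eqmodP/asboolP|uv] //; apply/eqmodP/asboolP.
Qed.

Lemma pres_reprP u : pres_cong rel (pres_repr (pres_class u)) u.
Proof. by apply/pres_classP; rewrite pres_reprK. Qed.

Definition pres_one : presented := pres_class [::].
Definition pres_mul (x y : presented) : presented :=
  pres_class (pres_repr x ++ pres_repr y).
Definition pres_inv (x : presented) : presented :=
  pres_class (word_inv (pres_repr x)).

Lemma pres_mul_class u v :
  pres_mul (pres_class u) (pres_class v) = pres_class (u ++ v).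
Proof. by apply/pres_classP; apply: PresCat; exact: pres_reprP. Qed.

Fact pres_mulA : associative pres_mul.
Proof.
move=> x y z; rewrite -(pres_reprK x) -(pres_reprK y) -(pres_reprK z).
by rewrite !pres_mul_class catA.
Qed.

Fact pres_mul1g : left_id pres_one pres_mul.
Proof. by move=> x; rewrite -(pres_reprK x) pres_mul_class. Qed.

Fact pres_mulg1 : right_id pres_one pres_mul.
Proof. by move=> x; rewrite -(pres_reprK x) pres_mul_class cats0. Qed.

Lemma pres_cong_cancel u : pres_cong rel (u ++ word_inv u) [::].
Proof.
elim: u => [|[x b] u IHu]; first exact: PresRefl.
rewrite /word_inv /= rev_cons -cats1 catA -/(word_inv u).
apply: PresTrans (PresCancel _ x b).
apply: (@PresCat _ _ ((x, b) :: (u ++ word_inv u)) [:: (x, b)]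
  [:: (x, ~~ b)] [:: (x, ~~ b)]); last exact: PresRefl.
apply: (@PresCat _ _ [:: (x, b)] [:: (x, b)] (u ++ word_inv u) [::]) IHu.
exact: PresRefl.
Qed.

Lemma word_invK : involutive (@word_inv X).
Proof.
move=> u; rewrite /word_inv map_rev revK -map_comp -[RHS]map_id.
by apply: eq_map => -[x b] /=; rewrite negbK.
Qed.

Fact pres_mulgV : right_inverse pres_one pres_inv pres_mul.
Proof.
move=> x; rewrite -[X in pres_mul X _]pres_reprK pres_mul_class.
by apply/pres_classP/pres_cong_cancel.
Qed.

Fact pres_mulVg : left_inverse pres_one pres_inv pres_mul.
Proof.
move=> x; rewrite -[X in pres_mul _ X]pres_reprK pres_mul_class.
apply/pres_classP; rewrite -[X in _ ++ X]word_invK.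
exact: pres_cong_cancel.
Qed.

HB.instance Definition _ := isGroup.Build presented
  pres_mulA pres_mul1g pres_mulg1 pres_mulVg pres_mulgV.

Section Lift.
Variables (H : groupType) (f : X -> H).

Definition word_eval (u : word X) : H :=
  \prod_(l <- u) (if l.2 then (f l.1)^-1 else f l.1).

Lemma word_eval_positive u : word_eval (positive_word u) = \prod_(x <- u) f x.
Proof. by rewrite /word_eval big_map. Qed.

Hypothesis frel :
  forall u v, rel u v -> \prod_(x <- u) f x = \prod_(x <- v) f x.

Lemma word_eval_cong u v : pres_cong rel u v -> word_eval u = word_eval v.
Proof.
elim=> {u v} // [u v w _ -> _ -> //|u u' v v' _ Eu _ Ev|x b|u v /frel uv].
- by rewrite /word_eval !big_cat /= -/(word_eval u) Eu -/(word_eval v) Ev.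
- rewrite /word_eval !big_cons big_nil mulg1.
  by case: b; rewrite ?mulgV ?mulVg.
- by rewrite !word_eval_positive.
Qed.

Definition pres_lift of
    (forall u v, rel u v -> \prod_(x <- u) f x = \prod_(x <- v) f x) :=
  fun x : presented => word_eval (pres_repr x).

Local Notation lift := (pres_lift frel).

Lemma pres_lift_class u : lift (pres_class u) = word_eval u.
Proof. exact/word_eval_cong/pres_reprP. Qed.

Lemma pres_lift_gen x : lift (pres_gen x) = f x.
Proof. by rewrite pres_lift_class /word_eval big_seq1. Qed.

Fact pres_lift_monoid_morphism : monoid.monoid_morphism lift.
Proof.
split=> [|x y]; first by rewrite pres_lift_class /word_eval big_nil.
rewrite -(pres_reprK x) -(pres_reprK y) [pres_class _ * _]pres_mul_class.
by rewrite !pres_lift_class /word_eval big_cat.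
Qed.

HB.instance Definition _ :=
  isUMagmaMorphism.Build presented H lift pres_lift_monoid_morphism.

End Lift.

Lemma pres_class_positive u :
  pres_class (positive_word u) = \prod_(x <- u) pres_gen x.
Proof.
elim: u => [|x u IHu]; first by rewrite big_nil.
by rewrite big_cons -IHu /pres_gen [RHS]pres_mul_class.
Qed.

Lemma pres_gen_rel u v :
  rel u v -> \prod_(x <- u) pres_gen x = \prod_(x <- v) pres_gen x.
Proof. by move=> uv; rewrite -!pres_class_positive; apply/pres_classP/PresRel. Qed.

End Presentation.

Definition is_subgroup (G : groupType) (H : set G) : Prop :=
  [/\ H 1, forall x y, H x -> H y -> H (x * y) & forall x, H x -> H x^-1].

Definition gen_subgroup (G : groupType) (A : set G) : set G :=
  \bigcap_(H in [set H | is_subgroup H /\ A `<=` H]) H.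

Record normal_subgroup (G : groupType) := NormalSubgroup {
  nsg_set : set G;
  nsg_subgroup : is_subgroup nsg_set;
  nsg_conj : forall x y, nsg_set x -> nsg_set (x ^ y)
}.

Section Quotient.
Variables (G : groupType) (N : normal_subgroup G).

Definition coset_eq (x y : G) : bool := `[< nsg_set N (x^-1 * y) >].

Fact coset_eq_refl : reflexive coset_eq.
Proof.
by move=> x; apply/asboolP; rewrite mulVg; case: (nsg_subgroup N).
Qed.

Fact coset_eq_sym : symmetric coset_eq.
Proof.
have [_ _ NV] := nsg_subgroup N.
by move=> x y; apply/asboolP/asboolP => /NV; rewrite invgM invgK.
Qed.

Fact coset_eq_trans : transitive coset_eq.
Proof.
have [_ NM _] := nsg_subgroup N.
move=> y x z /asboolP xy /asboolP yz; apply/asboolP.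
by have := NM _ _ xy yz; rewrite -mulgA mulVKg.
Qed.

Canonical coset_equiv :=
  EquivRel coset_eq coset_eq_refl coset_eq_sym coset_eq_trans.

Definition gquotient : Type := {eq_quot coset_equiv}.
HB.instance Definition _ := Choice.on gquotient.

Definition gcoset (x : G) : gquotient := \pi_({eq_quot coset_equiv}) x.
Definition coset_repr (x : gquotient) : G := repr (x : {eq_quot coset_equiv}).

Lemma coset_reprK x : gcoset (coset_repr x) = x.
Proof. exact: reprK. Qed.

Lemma cosetP x y : gcoset x = gcoset y <-> nsg_set N (x^-1 * y).
Proof. by split=> [/eqmodP/asboolP|xy] //; apply/eqmodP/asboolP. Qed.

Definition quotient_one : gquotient := gcoset 1.
Definition quotient_mul (x y : gquotient) : gquotient :=
  gcoset (coset_repr x * coset_repr y).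
Definition quotient_inv (x : gquotient) : gquotient := gcoset (coset_repr x)^-1.

Lemma quotient_mul_coset x y : quotient_mul (gcoset x) (gcoset y) = gcoset (x * y).
Proof.
have [_ NM _] := nsg_subgroup N.
apply/cosetP; set x' := coset_repr _; set y' := coset_repr _.
have Nx : nsg_set N (x'^-1 * x) by apply/cosetP; rewrite coset_reprK.
have Ny : nsg_set N (y'^-1 * y) by apply/cosetP; rewrite coset_reprK.
rewrite invgM.
have -> : y'^-1 * x'^-1 * (x * y) = (y'^-1 * y) * (x'^-1 * x) ^ y.
  by rewrite conjgE !mulgA mulgK.
by apply: NM Ny _; exact: nsg_conj.
Qed.

Lemma quotient_inv_coset x : quotient_inv (gcoset x) = gcoset x^-1.
Proof.
have [_ _ NV] := nsg_subgroup N.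
apply/cosetP; set x' := coset_repr _; rewrite invgK.
have Nx : nsg_set N (x'^-1 * x) by apply/cosetP; rewrite coset_reprK.
have := nsg_conj x^-1 (NV _ Nx).
by rewrite conjgE invgK !invgM invgK !mulgA mulgV mul1g.
Qed.

Fact quotient_mulA : associative quotient_mul.
Proof.
move=> x y z; rewrite -(coset_reprK x) -(coset_reprK y) -(coset_reprK z).
by rewrite !quotient_mul_coset mulgA.
Qed.

Fact quotient_mul1g : left_id quotient_one quotient_mul.
Proof. by move=> x; rewrite -(coset_reprK x) quotient_mul_coset mul1g. Qed.

Fact quotient_mulg1 : right_id quotient_one quotient_mul.
Proof. by move=> x; rewrite -(coset_reprK x) quotient_mul_coset mulg1. Qed.

Fact quotient_mulVg : left_inverse quotient_one quotient_inv quotient_mul.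
Proof.
by move=> x; rewrite -(coset_reprK x) quotient_inv_coset quotient_mul_coset mulVg.
Qed.

Fact quotient_mulgV : right_inverse quotient_one quotient_inv quotient_mul.
Proof.
by move=> x; rewrite -(coset_reprK x) quotient_inv_coset quotient_mul_coset mulgV.
Qed.

HB.instance Definition _ := isGroup.Build gquotient
  quotient_mulA quotient_mul1g quotient_mulg1 quotient_mulVg quotient_mulgV.

Fact coset_monoid_morphism : monoid.monoid_morphism gcoset.
Proof. by split=> [|x y] //; rewrite [RHS]quotient_mul_coset. Qed.

HB.instance Definition _ :=
  isUMagmaMorphism.Build G gquotient gcoset coset_monoid_morphism.

End Quotient.

Section Kernel.
Variables (G H : groupType) (f : monoid.UMagmaMorphism.type G H).

Fact kernel_subgroup : is_subgroup [set x : G | f x = 1].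
Proof.
split=> /= [|x y fx fy|x fx]; first exact: gmulf1.
- by rewrite gmulfM fx fy mulg1.
- by rewrite gmulfV fx invg1.
Qed.

Fact kernel_conj x y : [set x : G | f x = 1] x -> [set x : G | f x = 1] (x ^ y).
Proof. by move=> /= fx; rewrite gmulfJ fx conjgE mul1g mulVg. Qed.

Definition gkernel : normal_subgroup G :=
  NormalSubgroup kernel_subgroup kernel_conj.

End Kernel.

Section Derived.
Variables (G : groupType) (N : normal_subgroup G).

Definition commutators : set G :=
  [set z | exists x y : G, [/\ nsg_set N x, nsg_set N y & z = commg x y]].

Fact derived_is_subgroup : is_subgroup (gen_subgroup commutators).
Proof.
split=> [H [[]]//|x y Gx Gy H HA|x Gx H HA].
- by case: (HA) => -[_ HM _] _; apply: HM; [exact: Gx | exact: Gy].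
- by case: (HA) => -[_ _ HV] _; apply: HV; exact: Gx.
Qed.

Fact derived_conj x y :
  gen_subgroup commutators x -> gen_subgroup commutators (x ^ y).
Proof.
move=> Gx H [[H1 HM HV] HA]; apply: (Gx [set z | H (z ^ y)]); split.
  split=> /= [|a b|a]; first by rewrite conj1g.
  - by rewrite conjMg; exact: HM.
  - by rewrite conjVg; exact: HV.
move=> _ [a [b [Na Nb ->]]] /=; apply: HA; exists (a ^ y), (b ^ y).
by split; [exact: nsg_conj | exact: nsg_conj | rewrite conjRg].
Qed.

Definition derived_subgroup : normal_subgroup G :=
  NormalSubgroup derived_is_subgroup derived_conj.

End Derived.

Definition GLin (K : fieldType) (V : vectType K) : Type :=
  {f : 'End(V) | lker f == 0%VS}.

Section GeneralLinear.
Variables (K : fieldType) (V : vectType K).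

HB.instance Definition _ := Choice.on (GLin V).

Definition gl_fun (g : GLin V) : 'End(V) := sval g.

Lemma gl_fun_inj : injective gl_fun.
Proof. exact: val_inj. Qed.

Fact lker_id : lker (\1%VF : 'End(V)) == 0%VS.
Proof. by apply/lker0P => u v; rewrite !id_lfunE. Qed.

Fact lker_comp (f g : GLin V) : lker (gl_fun f \o gl_fun g)%VF == 0%VS.
Proof.
by apply/lker0P => u v; rewrite !comp_lfunE => /(lker0P (svalP f))/(lker0P (svalP g)).
Qed.

Fact lker_inv (f : GLin V) : lker (gl_fun f)^-1%VF == 0%VS.
Proof.
apply/lker0P => u v /(congr1 (gl_fun f)).
by rewrite !(lker0_lfunVK (svalP f)).
Qed.

Definition gl_one : GLin V := exist (fun h : 'End(V) => lker h == 0%VS) _ lker_id.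
Definition gl_mul (f g : GLin V) : GLin V :=
  exist (fun h : 'End(V) => lker h == 0%VS) _ (lker_comp f g).
Definition gl_inv (f : GLin V) : GLin V :=
  exist (fun h : 'End(V) => lker h == 0%VS) _ (lker_inv f).

Fact gl_mulA : associative gl_mul.
Proof. by move=> f g h; apply: gl_fun_inj; exact: comp_lfunA. Qed.

Fact gl_mul1g : left_id gl_one gl_mul.
Proof. by move=> f; apply: gl_fun_inj; exact: comp_lfun1l. Qed.

Fact gl_mulg1 : right_id gl_one gl_mul.
Proof. by move=> f; apply: gl_fun_inj; exact: comp_lfun1r. Qed.

Fact gl_mulVg : left_inverse gl_one gl_inv gl_mul.
Proof. by move=> f; apply: gl_fun_inj; exact: lker0_compVf (svalP f). Qed.

Fact gl_mulgV : right_inverse gl_one gl_inv gl_mul.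
Proof. by move=> f; apply: gl_fun_inj; exact: lker0_compfV (svalP f). Qed.

HB.instance Definition _ := isGroup.Build (GLin V)
  gl_mulA gl_mul1g gl_mulg1 gl_mulVg gl_mulgV.

Lemma gl_fun1 v : gl_fun 1 v = v.
Proof. exact: id_lfunE. Qed.

Lemma gl_funM f g v : gl_fun (f * g) v = gl_fun f (gl_fun g v).
Proof. exact: comp_lfunE. Qed.

End GeneralLinear.

(* None stands for the entry infinity. *)
Record coxeter_matrix (S : finType) := CoxeterMatrix {
  cox_m :> S -> S -> option nat;
  cox_m_diag : forall s, cox_m s s = Some 1%N;
  cox_m_sym : forall s t, cox_m s t = cox_m t s;
  cox_m_ge2 : forall s t k, s != t -> cox_m s t = Some k -> (2 <= k)%N
}.

(* Prod_R(x, y, n): the alternating word in x and y of length n whose rightmost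
   letter is y. *)
Fixpoint alt_word (X : Type) (x y : X) (n : nat) : seq X :=
  if n is n'.+1 then rcons (alt_word y x n') y else [::].

Inductive coxeter_rel (S : finType) (M : coxeter_matrix S) :
    seq S -> seq S -> Prop :=
| CoxSquare s : coxeter_rel M [:: s; s] [::]
| CoxBraid s t k : s != t -> M s t = Some k ->
    coxeter_rel M (alt_word t s k) (alt_word s t k).

(* The generators of VA[M] are sigma_s = inl s and tau_s = inr s. *)
Inductive virtual_artin_rel (S : finType) (M : coxeter_matrix S) :
    seq (S + S) -> seq (S + S) -> Prop :=
| VASigmaBraid s t k : s != t -> M s t = Some k ->
    virtual_artin_rel M (alt_word (inl t) (inl s) k) (alt_word (inl s) (inl t) k)
| VATauBraid s t k : s != t -> M s t = Some k ->
    virtual_artin_rel M (alt_word (inr t) (inr s) k) (alt_word (inr s) (inr t) k)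
| VATauSquare s : virtual_artin_rel M [:: inr s; inr s] [::]
| VAMixed s t k : s != t -> M s t = Some k ->
    virtual_artin_rel M
      (rcons (alt_word (inr s) (inr t) k.-1) (inl s))
      (inl (if odd k then t else s) :: alt_word (inr s) (inr t) k.-1).

Section VirtualArtin.
Variables (S : finType) (M : coxeter_matrix S).

Definition coxeter_group : Type := presented (coxeter_rel M).
HB.instance Definition _ := Group.on coxeter_group.

Definition virtual_artin : Type := presented (virtual_artin_rel M).
HB.instance Definition _ := Group.on virtual_artin.

Definition cox_gen (s : S) : coxeter_group := pres_gen (coxeter_rel M) s.
Definition va_sigma (s : S) : virtual_artin :=
  pres_gen (virtual_artin_rel M) (inl s).
Definition va_tau (s : S) : virtual_artin :=
  pres_gen (virtual_artin_rel M) (inr s).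

Definition spherical : Prop := finite_set [set: coxeter_group].

Lemma map_alt (X Y : Type) (f : X -> Y) x y n :
  map f (alt_word x y n) = alt_word (f x) (f y) n.
Proof. by elim: n x y => //= n IHn x y; rewrite map_rcons IHn. Qed.

Lemma alt_cons (X : Type) (x y : X) n :
  alt_word x y n.+1 = (if odd n then x else y) :: alt_word x y n.
Proof.
elim: n x y => [|n IHn] x y //.
by rewrite [LHS]/(rcons (alt_word y x n.+1) y) IHn /=; case: (odd n).
Qed.

Definition va_to_cox (x : S + S) : coxeter_group :=
  match x with inl s => cox_gen s | inr s => cox_gen s end.

Fact va_to_cox_rel u v : virtual_artin_rel M u v ->
  \prod_(x <- u) va_to_cox x = \prod_(x <- v) va_to_cox x.
Proof.
move=> uv.
pose g (x : S + S) := match x with inl s => s | inr s => s end.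
have E w : \prod_(x <- w) va_to_cox x = \prod_(s <- map g w) cox_gen s.
  by rewrite big_map; apply: eq_bigr => -[].
rewrite !E; case: uv => {u v} [s t k nst Mst|s t k nst Mst|s|s t k nst Mst].
- by rewrite !map_alt; apply/pres_gen_rel/CoxBraid.
- by rewrite !map_alt; apply/pres_gen_rel/CoxBraid.
- exact/pres_gen_rel/CoxSquare.
- rewrite map_rcons /= !map_alt /=.
  have k_gt0 : (0 < k)%N by rewrite ltnW // (cox_m_ge2 nst Mst).
  case: k k_gt0 Mst => // k _ Mst /=.
  have -> : (if ~~ odd k then t else s) = if odd k then s else t.
    by case: (odd k).
  rewrite -[rcons _ _]/(alt_word t s k.+1) -alt_cons.
  exact/pres_gen_rel/CoxBraid.
Qed.

Definition pi_P : virtual_artin -> coxeter_group := pres_lift va_to_cox_rel.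
HB.instance Definition _ := monoid.UMagmaMorphism.on pi_P.

Fact va_tau_rel u v : coxeter_rel M u v ->
  \prod_(s <- u) va_tau s = \prod_(s <- v) va_tau s.
Proof.
move=> uv.
have E w : \prod_(s <- w) va_tau s =
    \prod_(x <- map inr w) pres_gen (virtual_artin_rel M) x :> virtual_artin.
  by rewrite big_map.
rewrite !E; case: uv => {u v} [s|s t k nst Mst].
- exact/pres_gen_rel/VATauSquare.
- by rewrite !map_alt; apply/pres_gen_rel/VATauBraid.
Qed.

Definition iota_W : coxeter_group -> virtual_artin := pres_lift va_tau_rel.
HB.instance Definition _ := monoid.UMagmaMorphism.on iota_W.

Definition PVA : normal_subgroup virtual_artin := gkernel pi_P.

Definition va_quotient : Type := gquotient (derived_subgroup PVA).
HB.instance Definition _ := Group.on va_quotient.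

Definition va_class : virtual_artin -> va_quotient := gcoset (derived_subgroup PVA).
HB.instance Definition _ := monoid.UMagmaMorphism.on va_class.

End VirtualArtin.

Section RootSystem.
Variables (R : realType) (S : finType) (M : coxeter_matrix S).

Local Open Scope ring_scope.

Definition root_space : vectType R := {ffun S -> R^o}.
Local Notation V := root_space.

Definition simple_root (s : S) : V := [ffun t => (t == s)%:R].

Definition cox_gram (s t : S) : R :=
  if M s t is Some k then - 2 * cos (pi / k%:R) else - 2.

Definition cox_form (u v : V) : R :=
  \sum_(s : S) \sum_(t : S) u s * v t * cox_gram s t.

Fact cox_form_linear v : linear (fun u => cox_form u v : R^o).
Proof.
move=> a u u'; rewrite /cox_form scaler_sumr -big_split /=.
apply: eq_bigr => s _; rewrite scaler_sumr -big_split /=.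
by apply: eq_bigr => t _; rewrite !ffunE /GRing.scale /= !mulrDl !mulrA.
Qed.

Lemma cox_formD u v w : cox_form (u + v) w = cox_form u w + cox_form v w.
Proof. by rewrite -[u]scale1r cox_form_linear !scale1r. Qed.

Lemma cox_formZ a u w : cox_form (a *: u) w = a * cox_form u w.
Proof.
have E : cox_form 0 w = 0.
  by apply: (addrI (cox_form 0 w)); rewrite -cox_formD !addr0.
by rewrite -[_ *: u]addr0 cox_form_linear E addr0.
Qed.

Lemma cox_formB u v w : cox_form (u - v) w = cox_form u w - cox_form v w.
Proof. by rewrite cox_formD -scaleN1r cox_formZ mulN1r. Qed.

Lemma cox_form_simple s t :
  cox_form (simple_root s) (simple_root t) = cox_gram s t.
Proof.
rewrite /cox_form (bigD1 s) //= (bigD1 t) //= !ffunE !eqxx !mul1r.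
rewrite !big1 ?addr0 // => [s' /negPf ns|t' /negPf nt].
  by rewrite big1 // => t' _; rewrite !ffunE ns !mul0r.
by rewrite !ffunE nt mulr0 mul0r.
Qed.

Definition reflection (s : S) (v : V) : V :=
  v - cox_form v (simple_root s) *: simple_root s.

Fact reflection_linear s : linear (reflection s).
Proof.
move=> a u v; rewrite /reflection cox_form_linear scalerBr scalerDl.
by rewrite opprD addrACA scalerA.
Qed.
HB.instance Definition _ s :=
  GRing.isLinear.Build R V V *:%R (reflection s) (reflection_linear s).

Lemma cox_gram_diag s : cox_gram s s = 2.
Proof. by rewrite /cox_gram cox_m_diag divr1 cospi mulrN1 opprK. Qed.

Lemma reflectionK s : involutive (reflection s).
Proof.
move=> v; rewrite /reflection cox_formB cox_formZ cox_form_simple cox_gram_diag.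
rewrite -addrA -opprD -scalerDl; set b := cox_form _ _.
have -> : b + (b - b * 2) = 0 by ring.
by rewrite scale0r subr0.
Qed.

Fact reflection_lker s : lker (linfun (reflection s)) == 0%VS.
Proof.
by apply/lker0P => u v; rewrite !lfunE => /(inv_inj (@reflectionK s)).
Qed.

Definition gl_reflection (s : S) : GLin V :=
  exist (fun h : 'End(V) => lker h == 0%VS) _ (reflection_lker s).

Lemma gl_reflectionE s v : gl_fun (gl_reflection s) v = reflection s v.
Proof. by rewrite /gl_fun /= lfunE. Qed.


Lemma cox_gram_sym s t : cox_gram s t = cox_gram t s.
Proof. by rewrite /cox_gram cox_m_sym. Qed.

Section Dihedral.
Variables (s t : S) (k : nat).
Hypotheses (nst : s != t) (Mst : M s t = Some k).

Let theta : R := pi / k%:R.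

Let k_ge2 : (2 <= k)%N. Proof. exact: cox_m_ge2 nst Mst. Qed.

Let k_gt0 : (0 < k%:R :> R). Proof. by rewrite ltr0n ltnW. Qed.

Let sin_theta : sin theta != 0.
Proof.
rewrite gt_eqF // sin_gt0_pi // /theta divr_gt0 ?pi_gt0 //=.
by rewrite ltr_pdivrMr // ltr_pMr ?pi_gt0 // ltr1n.
Qed.

Definition dihedral_coord (n : nat) (x y : R) : R :=
  (y * sin (n%:R * theta) - x * sin (n%:R * theta - theta)) / sin theta.
Local Notation X := dihedral_coord.

Lemma dihedral_coord0 x y : X 0 x y = x.
Proof. by rewrite /X mulr0n mul0r sin0 sub0r sinN mulr0 mulrN sub0r opprK mulfK. Qed.

Lemma dihedral_coord1 x y : X 1 x y = y.
Proof. by rewrite /X mulr1n mul1r subrr sin0 mulr0 subr0 mulfK. Qed.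

Lemma dihedral_coordS n x y : X n.+1 x y = X n y (2 * cos theta * y - x).
Proof.
rewrite /X; have -> : n.+1%:R = n%:R + 1 :> R by rewrite natr1.
rewrite (mulrDl n%:R) mul1r addrK sinD sinB; congr (_ / _); ring.
Qed.

Lemma dihedral_coordk x y : X k x y = - x.
Proof.
rewrite /X mulrC [k%:R * _]mulrC divfK ?gt_eqF // sinB sinpi cospi.
by rewrite mul0r mulN1r sub0r opprK mulr0 sub0r mulrN mulrCA mulVf ?mulr1.
Qed.

Lemma dihedral_coordSk x y : X k.+1 x y = - y.
Proof. by rewrite dihedral_coordS dihedral_coordk. Qed.

Lemma reflection_dihedral u x y : cox_form u (simple_root s) = 0 ->
  reflection s (u + x *: simple_root s + y *: simple_root t) =
  u + (2 * cos theta * y - x) *: simple_root s + y *: simple_root t.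
Proof.
move=> us; rewrite /reflection !cox_formD !cox_formZ us !cox_form_simple.
have -> : cox_gram t s = - 2 * cos theta by rewrite cox_gram_sym /cox_gram Mst.
rewrite cox_gram_diag add0r.
have -> : x * 2 + y * (- 2 * cos theta) = x - (2 * cos theta * y - x) by ring.
set z := _ * y - x; rewrite scalerBl opprB addrAC; congr (_ + _).
by rewrite -addrA [x *: _ + _]addrC subrK.
Qed.

Lemma dihedral_decomp v : exists (u : V) (x y : R),
  [/\ cox_form u (simple_root s) = 0, cox_form u (simple_root t) = 0 &
      v = u + x *: simple_root s + y *: simple_root t].
Proof.
set c := 2 * cos theta.
have c4 : 4 - c ^+ 2 != 0.
  have -> : 4 - c ^+ 2 = 4 * sin theta ^+ 2.
    transitivity (4 * (cos theta ^+ 2 + sin theta ^+ 2) - c ^+ 2).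
      by rewrite cos2Dsin2 mulr1.
    by rewrite /c; ring.
  by rewrite mulf_neq0 ?expf_neq0 // pnatr_eq0.
pose p := cox_form v (simple_root s); pose q := cox_form v (simple_root t).
pose x := (2 * p + c * q) / (4 - c ^+ 2).
pose y := (c * p + 2 * q) / (4 - c ^+ 2).
have st : cox_gram s t = - c by rewrite /cox_gram Mst mulNr.
exists (v - x *: simple_root s - y *: simple_root t), x, y; split.
- rewrite !cox_formB !cox_formZ !cox_form_simple -/p cox_gram_diag.
  by rewrite cox_gram_sym st /x /y; field.
- rewrite !cox_formB !cox_formZ !cox_form_simple -/q cox_gram_diag.
  by rewrite st /x /y; field.
- by rewrite addrAC subrK subrK.
Qed.

End Dihedral.

Lemma alt_reflection s t k n u x y : s != t -> M s t = Some k ->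
  cox_form u (simple_root s) = 0 -> cox_form u (simple_root t) = 0 ->
  gl_fun (\prod_(r <- alt_word t s n) gl_reflection r)%g
    (u + x *: simple_root s + y *: simple_root t) =
  if odd n then u + dihedral_coord k n.+1 x y *: simple_root s
                  + dihedral_coord k n x y *: simple_root t
  else u + dihedral_coord k n x y *: simple_root s
         + dihedral_coord k n.+1 x y *: simple_root t.
Proof.
move=> nst Mst us ut; elim: n s t x y nst Mst us ut => [|n IHn] s t x y nst Mst us ut.
  by rewrite big_nil gl_fun1 (dihedral_coord0 nst Mst) (dihedral_coord1 nst Mst).
rewrite big_rcons gl_funM gl_reflectionE (reflection_dihedral Mst) //.
rewrite addrAC IHn 1?eq_sym 1?cox_m_sym //= -!dihedral_coordS.
by case: (odd n) => /=; rewrite addrAC.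
Qed.

Fact gl_reflection_rel u v : coxeter_rel M u v ->
  (\prod_(s <- u) gl_reflection s)%g = (\prod_(s <- v) gl_reflection s)%g.
Proof.
move=> uv; apply: gl_fun_inj; apply/lfunP.
case: uv => {u v} [s|s t k nst Mst] v.
  rewrite !big_cons !big_nil mulg1 gl_funM !gl_reflectionE reflectionK.
  by rewrite gl_fun1.
have [u [x [y [us ut ->]]]] := dihedral_decomp nst Mst v.
have Mts : M t s = Some k by rewrite cox_m_sym.
have nts : t != s by rewrite eq_sym.
rewrite (alt_reflection _ _ _ nst Mst) // [in RHS]addrAC.
rewrite (alt_reflection _ _ _ nts Mts) //.
rewrite !(dihedral_coordk nst Mst) !(dihedral_coordSk nst Mst).
by case: (odd k); rewrite addrAC.
Qed.

Definition tits : coxeter_group M -> GLin V := pres_lift gl_reflection_rel.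
HB.instance Definition _ := monoid.UMagmaMorphism.on tits.

Lemma tits_gen s v : gl_fun (tits (cox_gen M s)) v = reflection s v.
Proof. by rewrite [tits _]pres_lift_gen gl_reflectionE. Qed.

Definition cox_roots : set V :=
  [set b | exists (w : coxeter_group M) (s : S),
     b = gl_fun (tits w) (simple_root s)].

(* The element iota_W(w) tau_s sigma_s iota_W(w)^-1 depends only on the root
   b = rho(w)(alpha_s), so for a root b the set below is a singleton and xget
   returns its element.  The default 1 is used only when b is not a root. *)
Definition zeta (b : V) : virtual_artin M :=
  xget 1%g [set z | exists (w : coxeter_group M) (s : S),
     b = gl_fun (tits w) (simple_root s) /\
     z = (iota_W w * (va_tau M s * va_sigma M s) * (iota_W w)^-1)%g].

Definition zeta_bar (b : V) : va_quotient M := va_class (zeta b).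

Definition zetas : set (virtual_artin M) := zeta @` cox_roots.

(* The element (\prod_b zeta_bar_b ^ a_b) theta.  In the spherical case there are
   finitely many roots (fset_set is empty on an infinite set).  The factors are
   images of elements of PVA[M], so they commute in VA[M] / PVA[M]' and the order
   of enumeration is irrelevant. *)
Definition va_quotient_elt (a : V -> int) (theta : coxeter_group M) :
    va_quotient M :=
  ((\prod_(b <- fset_set cox_roots) expgz (zeta_bar b) (a b)) *
     va_class (iota_W theta))%g.

(* theta acts by theta . zeta_b = zeta_(rho(theta)(b)), and w acts as theta. *)
Definition zeta_orbit (theta : coxeter_group M) (b : V) :
    set (virtual_artin M) :=
  [set zeta (gl_fun (tits (expgz theta n)) b) | n in [set: int]].

Definition orbit_representatives (theta : coxeter_group M)
    (T : set (virtual_artin M)) : Prop :=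
  T `<=` zetas /\
  forall b, cox_roots b -> exists! z, T z /\ zeta_orbit theta b z.

End RootSystem.

(* Main.v *)
(* Map VA[Gamma] to the semidirect product of the integer functions on V with GL(V)
   by sending sigma_s to (delta_{-alpha_s}, rho(s)) and tau_s to (0, rho(s)).  This
   kills PVA' and sends zeta_b to (delta_b, 1), so the classes of the zeta_b are
   independent in PVA / PVA'.  Conversely theta zeta_b theta^-1 = zeta_{theta b} holds
   already in VA: by Deodhar's argument, whenever w maps a simple root to a simple
   root, the mixed relations carry tau_s sigma_s along w.  Hence
     w^k = (prod_b zeta_b^{A_b}) theta^k,   A_b = sum_{i < k} a_{theta^-i b},
   which is trivial iff theta^k = 1 and every A_b vanishes; and if theta^k = 1 then,
   for an orbit O of theta and b in O, |O| A_b = k sum_{c in O} a_c. *)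
Require Import Defs.
From HB Require Import structures.
From mathcomp Require Import all_boot all_order all_algebra.
From mathcomp Require Import all_classical all_reals all_analysis.
From mathcomp Require Import finmap zify ring.

Set Implicit Arguments.
Unset Strict Implicit.
Unset Printing Implicit Defensive.

Import Order.TTheory GRing.Theory Num.Theory.

Local Open Scope classical_set_scope.
Local Open Scope ring_scope.

(** * Induction in presented groups *)

Lemma presented_ind (X : choiceType) (rel : seq X -> seq X -> Prop)
    (P : presented rel -> Prop) :
  P 1%g ->
  (forall x z, P z -> P (pres_gen rel x * z)%g) ->
  (forall x z, P z -> P ((pres_gen rel x)^-1 * z)%g) ->
  forall z, P z.
Proof.
move=> P1 PM PV z; rewrite -(pres_reprK z).
elim: (pres_repr z) => [|[x b] u IHu]; first exact: P1.
have -> : pres_class rel ((x, b) :: u) =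
    (pres_class rel [:: (x, b)] * pres_class rel u)%g.
  by rewrite [RHS]pres_mul_class.
case: b; last exact: PM.
suff -> : pres_class rel [:: (x, true)] = (pres_gen rel x)^-1%g by exact: PV.
apply/esym/mulg1_eq; rewrite [LHS]pres_mul_class.
exact/pres_classP/(PresCancel rel x false).
Qed.

Lemma presented_morph_eq (X : choiceType) (rel : seq X -> seq X -> Prop)
    (H : groupType) (f g : monoid.UMagmaMorphism.type (presented rel) H) :
  (forall x, f (pres_gen rel x) = g (pres_gen rel x)) -> f =1 g.
Proof.
move=> fg; elim/presented_ind => [|x z IHz|x z IHz]; first by rewrite !gmulf1.
  by rewrite !gmulfM IHz fg.
by rewrite !gmulfM !gmulfV IHz fg.
Qed.

(** * Word length in Coxeter groups and dihedral decompositions *)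

Section CoxeterLength.
Variables (S : finType) (M : coxeter_matrix S).
Local Open Scope group_scope.
Local Notation W := (coxeter_group M).
Local Notation gen := (cox_gen M).

Definition cox_prod (u : seq S) : W := \prod_(s <- u) gen s.

Lemma cox_prod_cat u v : cox_prod (u ++ v) = cox_prod u * cox_prod v.
Proof. exact: big_cat. Qed.

Lemma cox_prod_cons s u : cox_prod (s :: u) = gen s * cox_prod u.
Proof. exact: big_cons. Qed.

Lemma cox_prod_rcons u s : cox_prod (rcons u s) = cox_prod u * gen s.
Proof. by rewrite -cats1 cox_prod_cat /cox_prod big_seq1. Qed.

Lemma cox_gen_sq s : gen s * gen s = 1.
Proof.
by have := pres_gen_rel (CoxSquare M s); rewrite !big_cons !big_nil mulg1.
Qed.

Lemma cox_genV s : (gen s)^-1 = gen s.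
Proof. exact/mulg1_eq/cox_gen_sq. Qed.

Lemma cox_genK w s : w * gen s * gen s = w.
Proof. by rewrite -mulgA cox_gen_sq mulg1. Qed.

Lemma cox_prod_braid s t k : s != t -> M s t = Some k ->
  cox_prod (alt_word t s k) = cox_prod (alt_word s t k).
Proof. by move=> nst Mst; apply/pres_gen_rel/CoxBraid. Qed.

(** The boolean quantifier over tuples makes this a decidable predicate of [n], to which [ex_minn]
    applies in [cox_len]. *)
Lemma cox_prodP w : exists n, [exists u : n.-tuple S, cox_prod u == w].
Proof.
suff [u uw] : exists u, cox_prod u = w.
  by exists (size u); apply/existsP; exists (in_tuple u); apply/eqP.
elim/presented_ind: w => [|s z [u <-]|s z [u <-]]; first by exists [::]; exact: big_nil.
  by exists (s :: u); rewrite cox_prod_cons.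
by exists (s :: u); rewrite cox_prod_cons -[in RHS]/(gen s) cox_genV.
Qed.

Definition cox_len w : nat := ex_minn (cox_prodP w).

Lemma cox_len_word w : exists2 u, size u = cox_len w & cox_prod u = w.
Proof.
rewrite /cox_len; case: ex_minnP => n /existsP[u /eqP uw] _.
by exists u; rewrite ?size_tuple.
Qed.

Lemma cox_len_prod u : (cox_len (cox_prod u) <= size u)%N.
Proof.
rewrite /cox_len; case: ex_minnP => n _; apply.
by apply/existsP; exists (in_tuple u).
Qed.

Lemma cox_len_mul_prod w u : (cox_len (w * cox_prod u)%g <= cox_len w + size u)%N.
Proof.
have [v <- <-] := cox_len_word w; rewrite -cox_prod_cat -size_cat.
exact: cox_len_prod.
Qed.

Lemma cox_len_mul_gen w s : (cox_len (w * gen s)%g <= (cox_len w).+1)%N.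
Proof.
have := cox_len_mul_prod w [:: s].
by rewrite /cox_prod big_seq1 addn1.
Qed.

Lemma cox_len_descent w s : (cox_len (w * gen s)%g < cox_len w)%N ->
  cox_len w = (cox_len (w * gen s)%g).+1.
Proof. by have := cox_len_mul_gen (w * gen s) s; rewrite cox_genK; lia. Qed.

Lemma cox_descent_exists w :
  w = 1 \/ exists s, (cox_len (w * gen s)%g < cox_len w)%N.
Proof.
have [u] := cox_len_word w; case/lastP: u => [|u s] Hu uw.
  by left; rewrite -uw; exact: big_nil.
right; exists s; rewrite -Hu -uw cox_prod_rcons cox_genK size_rcons ltnS.
exact: cox_len_prod.
Qed.

Lemma alt_word_split (X : Type) (x y : X) n k :
  exists2 u, size u = n & alt_word x y (n + k) = u ++ alt_word x y k.
Proof.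
elim: n => [|n [u su uE]]; first by exists [::].
rewrite addSn alt_cons uE.
by exists ((if odd (n + k) then x else y) :: u); rewrite //= su.
Qed.

Lemma size_alt_word (X : Type) (x y : X) n : size (alt_word x y n) = n.
Proof. by elim: n x y => //= n IHn x y; rewrite size_rcons IHn. Qed.

(* v is the minimal representative of the coset of w modulo the dihedral subgroup
   generated by s and t. *)
Lemma cox_strip w s t : (cox_len (w * gen t)%g < cox_len w)%N ->
  exists v n, [/\ w = v * cox_prod (alt_word s t n.+1),
    cox_len w = (cox_len v + n.+1)%N,
    (cox_len v <= cox_len (v * gen s)%g)%N & (cox_len v <= cox_len (v * gen t)%g)%N].
Proof.
have [N] := ubnP (cox_len w); elim: N w s t => // N IHN w s t lt_wN wt.
have lw := cox_len_descent wt.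
have [le_s|lt_s] := leqP (cox_len (w * gen t)%g) (cox_len (w * gen t * gen s)%g).
  exists (w * gen t), 0%N; split=> //; last by rewrite cox_genK ltnW.
  - by rewrite /cox_prod big_seq1 cox_genK.
  - by rewrite addn1.
have [|v [n [E l ? ?]]] := IHN (w * gen t) t s _ lt_s; first by lia.
exists v, n.+1; split=> //; last by lia.
by rewrite -[LHS](cox_genK _ t) E -mulgA -cox_prod_rcons.
Qed.

(** If [w] is not 1, it has a descent [t], and [t] differs from [s] because [s] is not a descent;
    [cox_strip] then splits off the dihedral part. An alternating part of length at least [m(s,t)]
    could be rewritten to end in [s], which would make [s] a descent. *)
Lemma cox_decomp w s : (cox_len w <= cox_len (w * gen s)%g)%N ->
  w = 1 \/ exists t v n, [/\ s != t, w = v * cox_prod (alt_word s t n.+1),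
    (cox_len v < cox_len w)%N,
    (cox_len v <= cox_len (v * gen s)%g)%N /\
    (cox_len v <= cox_len (v * gen t)%g)%N &
    forall k, M s t = Some k -> (n.+1 < k)%N].
Proof.
move=> ws; have [|[t wt]] := cox_descent_exists w; [by left|right].
have nst : s != t by apply: contraTneq wt => <-; rewrite -leqNgt.
have [v [n [E l vs vt]]] := cox_strip s wt.
exists t, v, n; split=> //; first by lia.
move=> k Mst; rewrite ltnNge; apply/negP => le_kn.
have k_ge2 := cox_m_ge2 nst Mst.
(* Only the last [k] letters are braided; after that the final [s] cancels against the factor
   [gen s]. *)
have [u su uE] := alt_word_split s t (n.+1 - k) k.
move: ws; apply/negP; rewrite -ltnNge {1}E -(subnK le_kn) uE cox_prod_cat.
rewrite -cox_prod_braid // -(prednK (ltnW k_ge2)) /= cox_prod_rcons.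
rewrite !mulgA cox_genK -mulgA -cox_prod_cat.
apply: leq_ltn_trans (cox_len_mul_prod _ _) _.
rewrite size_cat su size_alt_word; lia.
Qed.

End CoxeterLength.

(** * Positivity of roots *)

Section Roots.
Variables (R : realType) (S : finType) (M : coxeter_matrix S).
Local Notation V := (root_space R S).
Local Notation gen := (cox_gen M).
Local Notation alpha := (@simple_root R S).
Local Notation rho w := (gl_fun (tits R (w : coxeter_group M))).

Lemma tits1 v : rho 1%g v = v.
Proof. by rewrite gmulf1 gl_fun1. Qed.

Lemma titsM w w' v : rho (w * w')%g v = rho w (rho w' v).
Proof. by rewrite gmulfM gl_funM. Qed.

Lemma titsK w : cancel (rho w) (rho w^-1%g).
Proof. by move=> v; rewrite -titsM mulVg tits1. Qed.

Lemma titsVK w : cancel (rho w^-1%g) (rho w).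
Proof. by move=> v; rewrite -titsM mulgV tits1. Qed.

(* The coefficients of the roots of the dihedral system spanned by alpha s and
   alpha t: Chebyshev polynomials of the second kind in cos (pi / m). *)
Definition dihedral_coef (s t : S) (n : nat) : R :=
  if M s t is Some k then sin (n%:R * (pi / k%:R)) / sin (pi / k%:R) else n%:R.

Lemma dihedral_coef_sym s t n : dihedral_coef s t n = dihedral_coef t s n.
Proof. by rewrite /dihedral_coef cox_m_sym. Qed.

Lemma dihedral_coefSS s t n :
  dihedral_coef s t n.+2 =
  - cox_gram R M s t * dihedral_coef s t n.+1 - dihedral_coef s t n.
Proof.
rewrite /dihedral_coef /cox_gram; case: (M s t) => [k|]; last first.
  by rewrite !mulrS; ring.
set x := pi / k%:R.
have E m : m.+1%:R * x = m%:R * x + x by rewrite mulrS mulrDl mul1r addrC.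
rewrite !E (sinD (n%:R * x + x)) (sinD (n%:R * x)) (cosD (n%:R * x)).
have -> : sin (n%:R * x) / sin x = (sin (n%:R * x) * (cos x ^+ 2 + sin x ^+ 2)) / sin x.
  by rewrite cos2Dsin2 mulr1.
by ring.
Qed.

Lemma sin_pi_div_gt0 k : (2 <= k)%N -> 0 < sin (pi / k%:R) :> R.
Proof.
move=> k_ge2; have k_gt0 : 0 < k%:R :> R by rewrite ltr0n ltnW.
rewrite sin_gt0_pi // divr_gt0 ?pi_gt0 //=.
by rewrite ltr_pdivrMr // ltr_pMr ?pi_gt0 // ltr1n.
Qed.

Lemma dihedral_coef0 s t : dihedral_coef s t 0 = 0.
Proof. by rewrite /dihedral_coef; case: (M s t) => // k; rewrite mul0r sin0 mul0r. Qed.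

Lemma dihedral_coef1 s t : s != t -> dihedral_coef s t 1 = 1.
Proof.
move=> nst; rewrite /dihedral_coef; case Mst: (M s t) => [k|] //.
by rewrite mul1r divff // gt_eqF // sin_pi_div_gt0 // (cox_m_ge2 nst Mst).
Qed.

Lemma dihedral_coef_gt0 s t n : s != t -> (0 < n)%N ->
  (forall k, M s t = Some k -> (n < k)%N) -> 0 < dihedral_coef s t n.
Proof.
move=> nst n_gt0; rewrite /dihedral_coef; case Mst: (M s t) => [k|] nk; last first.
  by rewrite ltr0n.
have k_ge2 := cox_m_ge2 nst Mst; have {}nk := nk k erefl.
have k_gt0 : 0 < k%:R :> R by rewrite ltr0n ltnW.
rewrite divr_gt0 ?sin_pi_div_gt0 // sin_gt0_pi // mulr_gt0 ?ltr0n //=.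
  by rewrite mulrA ltr_pdivrMr // mulrC ltr_pM2l ?pi_gt0 // ltr_nat.
by rewrite divr_gt0 ?pi_gt0.
Qed.

(** This is [sin (pi - x) = sin x]. It gives the coefficients 1 and 0 at the indices [k - 1] and
    [k]. *)
Lemma dihedral_coef_sub s t k n : s != t -> M s t = Some k -> (n <= k)%N ->
  dihedral_coef s t (k - n) = dihedral_coef s t n.
Proof.
move=> nst Mst nk; rewrite /dihedral_coef Mst; congr (_ / _).
have k_ge2 := cox_m_ge2 nst Mst.
have k_gt0 : 0 < k%:R :> R by rewrite ltr0n ltnW.
rewrite natrB // mulrBl mulrC divfK ?gt_eqF // sinB sinpi cospi.
by rewrite mul0r sub0r mulN1r opprK.
Qed.

Lemma reflection_dihedral_coef s t n :
  reflection M s (dihedral_coef s t n *: alpha s + dihedral_coef s t n.+1 *: alpha t)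
  = dihedral_coef s t n.+2 *: alpha s + dihedral_coef s t n.+1 *: alpha t.
Proof.
rewrite /reflection cox_formD !cox_formZ !cox_form_simple cox_gram_diag.
rewrite dihedral_coefSS (cox_gram_sym R M t s) addrAC -scalerBl.
by congr (_ *: _ + _); ring.
Qed.

(** Each letter added on the left changes one of the two coefficients by the three-term recurrence,
    so the pair of consecutive coefficients advances by one index. *)
Lemma tits_alt_word s t n : s != t ->
  rho (cox_prod M (alt_word s t n)) (alpha s) =
  dihedral_coef s t n *: alpha (if odd n then s else t) +
  dihedral_coef s t n.+1 *: alpha (if odd n then t else s).
Proof.
move=> nst; elim: n => [|n IHn].
  by rewrite /cox_prod big_nil tits1 dihedral_coef0 dihedral_coef1 // scale0r
    add0r scale1r.
rewrite alt_cons cox_prod_cons titsM IHn tits_gen /=.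
case: (odd n) => /=; first by rewrite reflection_dihedral_coef addrC.
by rewrite !(dihedral_coef_sym s) reflection_dihedral_coef addrC.
Qed.

Definition nonneg_vector (v : V) : Prop := forall s, 0 <= v s.

Lemma nonneg_simple s : nonneg_vector (alpha s).
Proof. by move=> t; rewrite ffunE ler0n. Qed.

Lemma nonneg_vectorD u v : nonneg_vector u -> nonneg_vector v -> nonneg_vector (u + v).
Proof. by move=> Hu Hv s; rewrite !ffunE addr_ge0. Qed.

Lemma nonneg_vectorZ (x : R) v : 0 <= x -> nonneg_vector v -> nonneg_vector (x *: v).
Proof. by move=> Hx Hv s; rewrite !ffunE mulr_ge0. Qed.

Lemma dihedral_coef_ge0 s t n : s != t ->
  (forall k, M s t = Some k -> (n <= k)%N) -> 0 <= dihedral_coef s t n.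
Proof.
move=> nst nk; have [->|n_gt0] := posnP n; first by rewrite dihedral_coef0.
case Mst: (M s t) nk => [k|] nk; last first.
  by rewrite ltW // dihedral_coef_gt0 // => k; rewrite Mst.
have := nk k erefl; rewrite leq_eqVlt => /orP[/eqP->|lt_nk].
  by rewrite -(dihedral_coef_sub nst Mst) // subnn dihedral_coef0.
by rewrite ltW // dihedral_coef_gt0 // => k'; rewrite Mst => -[<-].
Qed.

(** Induction on length through [cox_decomp]: the dihedral factor is shorter than [m(s,t)], so it
    sends [alpha s] to a combination of [alpha s] and [alpha t] with nonnegative coefficients, and
    the shorter factor [v] maps both of these to nonnegative vectors. *)
Lemma tits_nonneg w s :
  (cox_len w <= cox_len (w * gen s)%g)%N -> nonneg_vector (rho w (alpha s)).
Proof.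
have [N] := ubnP (cox_len w); elim: N w s => // N IHN w s lt_wN ws.
have [->|[t [v [n [nst wE lt_vw [vs vt] nk]]]]] := cox_decomp ws.
  by rewrite tits1; exact: nonneg_simple.
have Hs : nonneg_vector (rho v (alpha s)) by apply: IHN vs; lia.
have Ht : nonneg_vector (rho v (alpha t)) by apply: IHN vt; lia.
rewrite wE titsM tits_alt_word // linearD !linearZ /=.
apply: nonneg_vectorD; apply: nonneg_vectorZ; try by case: ifP.
- by apply: dihedral_coef_ge0 => // k /nk; lia.
- by apply: dihedral_coef_ge0 => // k /nk; lia.
Qed.

(** If [s] were a descent, positivity would apply to [w * gen s], which sends [alpha s] to
    [- alpha r]. *)
Lemma simple_not_descent w s r : rho w (alpha s) = alpha r ->
  (cox_len w <= cox_len (w * gen s)%g)%N.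
Proof.
move=> wsr; rewrite leqNgt; apply/negP => lt_ws.
have /tits_nonneg : (cox_len (w * gen s)%g <= cox_len (w * gen s * gen s)%g)%N.
  by rewrite cox_genK ltnW.
rewrite titsM tits_gen /reflection cox_form_simple cox_gram_diag.
rewrite scalerDl scale1r opprD addNKr linearN /= wsr => /(_ r).
by rewrite !ffunE eqxx oppr_ge0 ler10.
Qed.

Lemma nonneg_sum_simple u v r : nonneg_vector u -> nonneg_vector v ->
  u + v = alpha r -> u = u r *: alpha r.
Proof.
move=> Hu Hv uv; apply/ffunP => t; rewrite !ffunE.
have [->|ntr] := eqVneq t r; first by rewrite [RHS]mulr1.
have := congr1 (fun f : V => f t) uv; rewrite !ffunE (negPf ntr) => /eqP.
by rewrite paddr_eq0 // [RHS]mulr0 => /andP[/eqP-> _].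
Qed.

Lemma simple_root_indep s t (x y : R) : s != t ->
  x *: alpha s = y *: alpha t -> x = 0.
Proof.
move=> nst /ffunP/(_ s); rewrite !ffunE eqxx (negPf nst).
by rewrite [LHS]mulr1 [RHS]mulr0.
Qed.

Lemma simple_root_neq0 s : alpha s != 0.
Proof.
by apply/eqP => /ffunP/(_ s); rewrite !ffunE eqxx => /eqP; rewrite oner_eq0.
Qed.

Lemma tits_simple_neq0 w s : rho w (alpha s) != 0.
Proof.
apply: contraNneq (simple_root_neq0 s) => E.
by rewrite -(titsK w (alpha s)) E linear0.
Qed.

Lemma simple_root_inj : injective alpha.
Proof.
move=> s t /ffunP/(_ s); rewrite !ffunE eqxx.
by case: eqP => // _ /eqP; rewrite oner_eq0.
Qed.

(** A simple root spans an extremal ray of the cone of nonnegative vectors, so both summands would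
    be multiples of [alpha r]; but [rho v] is injective and [alpha s], [alpha t] are independent. *)
Lemma nonneg_comb_not_simple v s t r (x y : R) : s != t ->
  nonneg_vector (rho v (alpha s)) -> nonneg_vector (rho v (alpha t)) ->
  0 < x -> 0 < y -> rho v (x *: alpha s + y *: alpha t) <> alpha r.
Proof.
move=> nst Hs Ht x0 y0; rewrite linearD !linearZ /= => E.
have Hx := nonneg_vectorZ (ltW x0) Hs; have Hy := nonneg_vectorZ (ltW y0) Ht.
have [p Es] : exists p, x *: rho v (alpha s) = p *: alpha r.
  by eexists; exact: nonneg_sum_simple Hx Hy E.
have [q Et] : exists q, y *: rho v (alpha t) = q *: alpha r.
  by eexists; apply: (nonneg_sum_simple Hy Hx); rewrite addrC.
have q0 : q != 0.
  apply/eqP => q0; move/eqP: Et; rewrite q0 scale0r scaler_eq0 gt_eqF //=.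
  exact/negP/tits_simple_neq0.
have : rho v ((q * x) *: alpha s) = rho v ((p * y) *: alpha t).
  by rewrite !linearZ /= -!scalerA Es Et !scalerA mulrC.
move/(can_inj (titsK v))/(simple_root_indep nst)/eqP.
by rewrite mulf_eq0 (negPf q0) gt_eqF.
Qed.

End Roots.

(** * Conjugation of the elements tau_s sigma_s *)

Section VirtualConjugation.
Variables (S : finType) (M : coxeter_matrix S).
Local Open Scope group_scope.
Local Notation tau := (va_tau M).
Local Notation sigma := (va_sigma M).

Lemma iota_gen s : iota_W (cox_gen M s) = tau s.
Proof. exact: pres_lift_gen. Qed.

Lemma iota_prod u : iota_W (cox_prod M u) = \prod_(s <- u) tau s.
Proof. by rewrite gmulf_prod; apply: eq_bigr => s _; exact: iota_gen. Qed.

(** The mixed relation moves [sigma s] across the alternating word of length [k - 1]. The factor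
    [tau s] completes that word to length [k], and the braid relation makes it start with
    [tau r]. *)
Lemma iota_alt_conj s t k : s != t -> M s t = Some k ->
  let r := if odd k then t else s in
  iota_W (cox_prod M (alt_word s t k.-1)) * (tau s * sigma s) =
  (tau r * sigma r) * iota_W (cox_prod M (alt_word s t k.-1)).
Proof.
move=> nst Mst r; have k_gt0 : (0 < k)%N by rewrite ltnW // (cox_m_ge2 nst Mst).
have mixed := pres_gen_rel (VAMixed nst Mst).
rewrite big_rcons big_cons -!(map_alt (@inr S S)) !big_map in mixed.
rewrite mulgA -{1}iota_gen -gmulfM -cox_prod_rcons.
have -> : rcons (alt_word s t k.-1) s = alt_word t s k by case: (k) k_gt0.
rewrite (cox_prod_braid nst Mst) -{1}(prednK k_gt0) alt_cons cox_prod_cons.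
have -> : (if odd k.-1 then s else t) = r.
  by rewrite /r; case: (k) k_gt0 => //= n _; case: (odd n).
rewrite gmulfM /= iota_gen iota_prod -!mulgA; congr (_ * _).
exact: mixed.
Qed.

(* Deodhar: if w maps a simple root to a simple root, then w is a product of
   elements of rank two parabolic subgroups with the same property, for which the
   claim is the mixed relation. *)
Lemma iota_conj (R : realType) w s r :
  gl_fun (tits R w) (simple_root R s) = simple_root R r ->
  iota_W w * (tau s * sigma s) = (tau r * sigma r) * iota_W w.
Proof.
have [N] := ubnP (cox_len w); elim: N w s => // N IHN w s lt_wN wsr.
have [w1|[t [v [n [nst wE lt_vw [vs vt] nk]]]]] :=
  cox_decomp (simple_not_descent wsr).
  by move: wsr; rewrite w1 tits1 gmulf1 mulg1 mul1g => /simple_root_inj->.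
have c_gt0 : (0 < dihedral_coef R M s t n.+1)%R by exact: dihedral_coef_gt0.
move: wsr; rewrite wE titsM tits_alt_word //.
have Hs := tits_nonneg R vs; have Ht := tits_nonneg R vt.
(* If [n + 1 < m(s,t) - 1], both coefficients are positive and the image cannot be simple. This
   leaves [n + 1 = m(s,t) - 1], the length in the mixed relation. *)
have [nk2|] := pselect (forall k, M s t = Some k -> (n.+2 < k)%N).
  have c2_gt0 : (0 < dihedral_coef R M s t n.+2)%R by exact: dihedral_coef_gt0.
  case: (odd n.+1); first by move/(nonneg_comb_not_simple nst Hs Ht c_gt0 c2_gt0).
  by rewrite addrC => /(nonneg_comb_not_simple nst Hs Ht c2_gt0 c_gt0).
move=> /existsNP[k /not_implyP[Mst /negP]]; rewrite -leqNgt => le_kn.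
have kE : k = n.+2 by have := nk k Mst; lia.
subst k.
have <- : dihedral_coef R M s t (n.+2 - n.+2) = dihedral_coef R M s t n.+2.
  exact: dihedral_coef_sub.
have <- : dihedral_coef R M s t (n.+2 - n.+1) = dihedral_coef R M s t n.+1.
  exact: dihedral_coef_sub.
(* The coefficients are now 1 and 0: the dihedral factor maps [alpha s] to a simple root, which [v]
   maps to [alpha r], so induction applies to [v]. *)
rewrite subnn subSn // subnn dihedral_coef0 dihedral_coef1 //.
rewrite scale1r scale0r addr0 => vr.
have {}IH := IHN v _ _ vr.
have := iota_alt_conj nst Mst; rewrite /= negbK => mixed.
rewrite gmulfM -mulgA mixed !mulgA; congr (_ * _).
rewrite mulgA in IH; rewrite -[RHS]IH ?mulgA; last by lia.
by rewrite /= ; case: (odd n).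
Qed.

(** Two expressions of one root by [w, s] and [w', s'] differ by [w'^-1 * w], which maps [alpha s]
    to [alpha s']; [iota_conj] then identifies the two conjugates. Thus [zeta] is well defined on
    roots. *)
Lemma zetaE (R : realType) (w : coxeter_group M) s :
  zeta M (gl_fun (tits R w) (simple_root R s)) =
  iota_W w * (tau s * sigma s) * (iota_W w)^-1.
Proof.
rewrite /zeta; case: xgetP => [z _ [w' [s' [E ->]]]|none]; last first.
  by case: (none (iota_W w * (tau s * sigma s) * (iota_W w)^-1)); exists w, s.
have /iota_conj : gl_fun (tits R (w'^-1 * w)) (simple_root R s) = simple_root R s'.
  by rewrite titsM E titsK.
rewrite gmulfM gmulfV -mulgA => /(congr1 (fun x => iota_W w' * x)).
rewrite mulVKg !mulgA => ->.
by rewrite mulgK.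
Qed.

Lemma cox_roots_tits (R : realType) (w : coxeter_group M) (b : root_space R S) :
  cox_roots M b -> cox_roots M (gl_fun (tits R w) b).
Proof. by move=> [w' [s ->]]; exists (w * w'), s; rewrite titsM. Qed.

Lemma zeta_tits (R : realType) (w : coxeter_group M) (b : root_space R S) :
  cox_roots M b ->
  zeta M (gl_fun (tits R w) b) = iota_W w * zeta M b * (iota_W w)^-1.
Proof.
by move=> [w' [s ->]]; rewrite -titsM !zetaE gmulfM invgM !mulgA.
Qed.

Lemma pi_P_iota w : pi_P (@iota_W S M w) = w.
Proof.
apply: (presented_morph_eq (f := pi_P (M := M) \o @iota_W S M) (g := idfun)) => s.
rewrite /= -/(cox_gen M s) iota_gen; exact: pres_lift_gen.
Qed.

Lemma pi_P_zeta (R : realType) (b : root_space R S) :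
  cox_roots M b -> pi_P (zeta M b) = 1.
Proof.
move=> [w [s ->]]; rewrite zetaE !gmulfM gmulfV /= pi_P_iota.
have -> : pi_P (tau s) = cox_gen M s by exact: pres_lift_gen.
have -> : pi_P (sigma s) = cox_gen M s by exact: pres_lift_gen.
by rewrite cox_gen_sq mulg1 mulgV.
Qed.

End VirtualConjugation.

(** * Linearization of VA[Gamma] *)

(** The kernel of such an [f] is a subgroup containing all commutators of [N], so [f] factors
    through the quotient by the derived subgroup. *)
Lemma gcoset_derived_inj (G H : groupType) (N : normal_subgroup G)
    (f : monoid.UMagmaMorphism.type G H) :
  (forall x y, nsg_set N x -> nsg_set N y -> commute (f x) (f y)) ->
  forall x y, gcoset (derived_subgroup N) x = gcoset (derived_subgroup N) y ->
  f x = f y.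
Proof.
move=> fN x y /cosetP xy.
suff : f (x^-1 * y)%g = 1%g by rewrite gmulfM gmulfV => /mulg1_eq; rewrite invgK.
apply: (xy [set z | f z = 1%g]); split; first exact: kernel_subgroup.
move=> _ [a [b [Na Nb ->]]] /=; rewrite gmulfR.
exact/eqP/commgP/fN.
Qed.

Lemma gcoset_derived_commute (G : groupType) (N : normal_subgroup G) x y :
  nsg_set N x -> nsg_set N y ->
  commute (gcoset (derived_subgroup N) x) (gcoset (derived_subgroup N) y).
Proof.
move=> Nx Ny; apply/commgP/eqP; rewrite -gmulfR; apply/cosetP.
by rewrite mulg1 invgR => H [_]; apply; exists y, x.
Qed.

Local Arguments gl_fun : simpl never.

(* The semidirect product of the functions V -> int and GL(V). *)
Definition twisted (K : fieldType) (V : vectType K) : Type :=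
  ((V -> int) * GLin V)%type.

Section Twisted.
Variables (K : fieldType) (V : vectType K).
Local Notation T := (twisted V).

HB.instance Definition _ := Choice.on T.

Definition twisted_one : T := (fun=> 0, 1%g).
Definition twisted_mul (x y : T) : T :=
  (fun v => x.1 v + y.1 (gl_fun x.2^-1%g v), (x.2 * y.2)%g).
Definition twisted_inv (x : T) : T :=
  (fun v => - x.1 (gl_fun x.2 v), x.2^-1%g).

Fact twisted_mulA : associative twisted_mul.
Proof.
move=> x y z; congr pair; last exact: mulgA.
by apply/funext => v /=; rewrite addrA invgM gl_funM.
Qed.

Fact twisted_mul1g : left_id twisted_one twisted_mul.
Proof.
move=> [f g]; congr pair; last exact: mul1g.
by apply/funext => v /=; rewrite add0r invg1 gl_fun1.
Qed.

Fact twisted_mulg1 : right_id twisted_one twisted_mul.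
Proof.
move=> [f g]; congr pair; last exact: mulg1.
by apply/funext => v /=; rewrite addr0.
Qed.

Fact twisted_mulVg : left_inverse twisted_one twisted_inv twisted_mul.
Proof.
move=> [f g]; congr pair; last exact: mulVg.
by apply/funext => v /=; rewrite invgK addNr.
Qed.

Fact twisted_mulgV : right_inverse twisted_one twisted_inv twisted_mul.
Proof.
move=> [f g]; congr pair; last exact: mulgV.
by apply/funext => v /=; rewrite -gl_funM mulgV gl_fun1 subrr.
Qed.

HB.instance Definition _ := isGroup.Build T
  twisted_mulA twisted_mul1g twisted_mulg1 twisted_mulVg twisted_mulgV.

Definition twisted_snd (x : T) : GLin V := x.2.

Fact twisted_snd_morphism : monoid.monoid_morphism twisted_snd.
Proof. by []. Qed.

HB.instance Definition _ :=
  isUMagmaMorphism.Build T (GLin V) twisted_snd twisted_snd_morphism.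

Lemma twisted_fstM (x y : T) v :
  (x * y)%g.1 v = x.1 v + y.1 (gl_fun x.2^-1%g v).
Proof. by []. Qed.

Lemma twisted_expr (x : T) k v :
  (x ^+ k)%g.1 v = \sum_(i < k) x.1 (gl_fun (x.2^-1 ^+ i)%g v).
Proof.
elim: k v => [|k IHk] v; first by rewrite big_ord0.
rewrite expgS twisted_fstM IHk big_ord_recl gl_fun1; congr (_ + _).
by apply: eq_bigr => i _; rewrite expgSr gl_funM.
Qed.

End Twisted.

Section Linearization.
Variables (R : realType) (S : finType) (M : coxeter_matrix S).
Local Notation V := (root_space R S).
Local Notation alpha := (@simple_root R S).
Local Notation rho w := (gl_fun (tits R (w : coxeter_group M))).

(* sigma_s carries - alpha s so that tau_s sigma_s is sent to the indicator of
   alpha s. *)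
Definition twisted_gen (x : S + S) : twisted V :=
  match x with
  | inl s => (fun v => (v == - alpha s)%:R, gl_reflection R M s)
  | inr s => (fun=> 0, gl_reflection R M s)
  end.

Lemma snd_twisted_prod (u : seq (S + S)) :
  (\prod_(x <- u) twisted_gen x)%g.2 = tits R (\prod_(x <- u) va_to_cox M x)%g.
Proof.
rewrite [LHS](gmulf_prod (@twisted_snd _ V)) gmulf_prod.
by apply: eq_bigr => -[] s _; apply/esym; exact: pres_lift_gen.
Qed.

Lemma fst_twisted_tau (u : seq S) v :
  (\prod_(s <- u) twisted_gen (inr s))%g.1 v = 0.
Proof.
elim: u v => [|s u IHu] v; first by rewrite big_nil.
by rewrite big_cons twisted_fstM IHu addr0.
Qed.

Lemma gl_reflectionV s : (gl_reflection R M s)^-1%g = gl_reflection R M s.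
Proof.
apply: mulg1_eq; apply: gl_fun_inj; apply/lfunP => v.
by rewrite gl_funM !gl_reflectionE reflectionK gl_fun1.
Qed.

(* The negatives of the roots in the sum are the inversions of the word. *)
Lemma fst_twisted_sigma s t n v : s != t ->
  (\prod_(x <- alt_word s t n) twisted_gen (inl x))%g.1 v =
  let p := if odd n then t else s in let q := if odd n then s else t in
  \sum_(i < n) (v == - (dihedral_coef R M s t i.+1 *: alpha p +
                        dihedral_coef R M s t i *: alpha q))%:R.
Proof.
move=> nst; elim: n v => [|n IHn] v; first by rewrite big_nil /= big_ord0.
rewrite alt_cons big_cons twisted_fstM IHn /= big_ord_recl /=.
have -> : (if ~~ odd n then t else s) = if odd n then s else t by case: (odd n).
have -> : (if ~~ odd n then s else t) = if odd n then t else s by case: (odd n).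
rewrite dihedral_coef0 dihedral_coef1 // scale1r scale0r addr0; congr (_ + _).
apply: eq_bigr => i _; congr (nat_of_bool _)%:R.
rewrite gl_reflectionV gl_reflectionE.
rewrite (can2_eq (reflectionK _ _) (reflectionK _ _)) linearN /=; congr (_ == - _).
rewrite addrC /bump add1n; case: (odd n); first exact: reflection_dihedral_coef.
by rewrite !(dihedral_coef_sym _ _ s t) reflection_dihedral_coef.
Qed.

(** The linear parts factor through the Coxeter group, so only the function parts need checking, and
    those vanish on words in the [tau] letters. *)
Fact twisted_gen_rel u v : virtual_artin_rel M u v ->
  (\prod_(x <- u) twisted_gen x)%g = (\prod_(x <- v) twisted_gen x)%g.
Proof.
move=> uv; suff E1 : (\prod_(x <- u) twisted_gen x)%g.1 =
                     (\prod_(x <- v) twisted_gen x)%g.1.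
  have E2 : (\prod_(x <- u) twisted_gen x)%g.2 = (\prod_(x <- v) twisted_gen x)%g.2.
    by rewrite !snd_twisted_prod (va_to_cox_rel uv).
  by rewrite [LHS]surjective_pairing E1 E2 -surjective_pairing.
apply/funext => b; case: uv => {u v} [s t k nst Mst|s t k nst Mst|s|s t k nst Mst].
- rewrite -!(map_alt inl) !big_map !fst_twisted_sigma //; last by rewrite eq_sym.
  (* The two words of length [k] have the same inversions listed in opposite orders;
     [dihedral_coef_sub] matches index [i] with [k - 1 - i]. *)
  rewrite /= [LHS](reindex_inj rev_ord_inj) /=; apply: eq_bigr => i _.
  rewrite !(dihedral_coef_sym R M t s) -subSn // subSS.
  rewrite (dihedral_coef_sub R nst Mst (ltnW (ltn_ord i))).
  rewrite (dihedral_coef_sub R nst Mst (ltn_ord i)).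
  by rewrite addrC.
- by rewrite -!(map_alt inr) !big_map !fst_twisted_tau.
- by have := fst_twisted_tau [:: s; s] b; rewrite !big_cons !big_nil.
- rewrite big_rcons big_cons -!(map_alt inr) !big_map !twisted_fstM.
  rewrite !fst_twisted_tau add0r addr0 /=.
  have -> : (\prod_(j <- alt_word s t k.-1) twisted_gen (inr j))%g.2 =
            tits R (cox_prod M (alt_word s t k.-1)).
    rewrite -(big_map inr xpredT twisted_gen) snd_twisted_prod big_map.
    by [].
  (* It remains that the alternating element of length [k - 1] carries [alpha s] to the simple root
     named on the right-hand side. *)
  congr (nat_of_bool _)%:R.
  rewrite -gmulfV (can2_eq (titsVK _) (titsK _)) linearN /= tits_alt_word //.
  have k_gt0 : (0 < k)%N by rewrite ltnW // (cox_m_ge2 nst Mst).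
  rewrite prednK // -(dihedral_coef_sub R nst Mst (leq_pred _)).
  rewrite -(dihedral_coef_sub R nst Mst (leqnn _)) subnn dihedral_coef0.
  have -> : (k - k.-1 = 1)%N by lia.
  rewrite dihedral_coef1 // scale1r scale0r addr0.
  by case: (k) k_gt0 => //= n _; case: (odd n).
Qed.

Definition linearize : virtual_artin M -> twisted V := pres_lift twisted_gen_rel.
HB.instance Definition _ := monoid.UMagmaMorphism.on linearize.

Lemma snd_linearize x : (linearize x).2 = tits R (pi_P x).
Proof.
apply: (presented_morph_eq (f := @twisted_snd _ V \o linearize)
  (g := @tits R S M \o pi_P (M := M))) => {}x /=.
have -> : linearize (pres_gen _ x) = twisted_gen x by exact: pres_lift_gen.
have -> : pi_P (pres_gen _ x) = va_to_cox M x by exact: pres_lift_gen.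
by apply/esym; case: x => s; exact: pres_lift_gen.
Qed.

Lemma linearize_iota w : linearize (iota_W w) = (fun=> 0, tits R w).
Proof.
have [u _ <-] := cox_len_word w.
rewrite [LHS]surjective_pairing snd_linearize pi_P_iota; congr pair.
apply/funext => v; rewrite iota_prod gmulf_prod -[RHS](fst_twisted_tau u v).
by congr (_.1 v); apply: eq_bigr => s _; exact: (pres_lift_gen twisted_gen_rel).
Qed.

Lemma linearize_zeta b : cox_roots M b ->
  linearize (zeta M b) = (fun v => (v == b)%:R, 1%g).
Proof.
move=> rb; rewrite [LHS]surjective_pairing snd_linearize pi_P_zeta // gmulf1.
congr pair; apply/funext => v; case: rb => w [s ->]; rewrite zetaE.
rewrite -gmulfV !gmulfM /= !linearize_iota.
have -> : linearize (va_tau M s) = twisted_gen (inr s) by exact: pres_lift_gen.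
have -> : linearize (va_sigma M s) = twisted_gen (inl s) by exact: pres_lift_gen.
rewrite /= !add0r addr0 gl_reflectionV gl_reflectionE.
rewrite (can2_eq (reflectionK _ _) (reflectionK _ _)) linearN /= -gmulfV.
rewrite (can2_eq (titsVK _) (titsK _)) linearN /= /reflection cox_form_simple.
by rewrite cox_gram_diag scalerDl scale1r opprD addNKr linearN /= opprK.
Qed.

(** Distinct roots give distinct indicator functions. This lets orbits of the [zeta] elements be
    read as orbits of roots. *)
Lemma zeta_inj (b c : V) : cox_roots M b -> cox_roots M c -> zeta M b = zeta M c -> b = c.
Proof.
move=> rb rc /(congr1 linearize); rewrite !linearize_zeta // => -[/funeqP/(_ b)].
by rewrite eqxx; case: eqP.
Qed.

Lemma linearize_PVA x : pi_P x = 1%g -> linearize x = ((linearize x).1, 1%g).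
Proof. by move=> px; rewrite [LHS]surjective_pairing snd_linearize px gmulf1. Qed.

(** Elements of PVA have trivial linear part, so their images lie in the abelian group of
    functions. *)
Lemma va_class_inj_linearize x y : va_class x = va_class y -> linearize x = linearize y.
Proof.
apply: gcoset_derived_inj => {}x {}y px py /=.
rewrite /commute (linearize_PVA px) (linearize_PVA py).
by congr pair; apply/funext => v /=; rewrite invg1 gl_fun1 addrC.
Qed.

Lemma va_class_inj_pi_P (x y : virtual_artin M) :
  va_class x = va_class y -> pi_P x = pi_P y.
Proof. by apply: gcoset_derived_inj => {}x {}y /= -> ->. Qed.

End Linearization.

(** * Powers in the quotient *)

Section Expgz.
Variables (G : groupType).
Implicit Types (x y : G) (n m : int).
Local Open Scope group_scope.

Lemma expgzS x n : expgz x (n + 1)%R = x * expgz x n.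
Proof.
case: n => [n|[|n]]; first by rewrite -PoszD addn1 /= expgS.
  by rewrite /= mulgV.
have -> : (Negz n.+1 + 1 = Negz n)%R by lia.
by rewrite /= [x ^+ n.+2]expgSr invgM mulVKg.
Qed.

Lemma expgzD x n m : expgz x (n + m)%R = expgz x n * expgz x m.
Proof.
have expgzB k : expgz x (k - 1)%R = x^-1 * expgz x k.
  by rewrite -{2}(subrK 1%R k) expgzS mulKg.
elim/int_rec: n => [|n IHn|n IHn]; first by rewrite add0r mul1g.
  by rewrite intS [(1 + n%:Z)%R]addrC addrAC !expgzS IHn mulgA.
by rewrite intS opprD [(-1 + _)%R]addrC addrAC !expgzB IHn mulgA.
Qed.

Lemma commute_expgz x y n m : commute x y -> commute (expgz x n) (expgz y m).
Proof.
move=> xy; have H z u k : commute z u -> commute z (expgz u k).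
  by move=> zu; case: k => k /=; [|apply: commuteV]; exact: commuteX.
exact/(H)/commute_sym/H/commute_sym.
Qed.

Lemma gmulf_expgz (H : groupType) (f : monoid.UMagmaMorphism.type G H) x n :
  f (expgz x n) = expgz (f x) n.
Proof. by case: n => n; rewrite /= ?gmulfV gmulfXn. Qed.

Lemma conj_expgz x y n : y * expgz x n * y^-1 = expgz (y * x * y^-1) n.
Proof.
have conjE z : y * z * y^-1 = z ^ y^-1 by rewrite conjgE invgK mulgA.
by rewrite !conjE; case: n => n /=; rewrite ?conjVg conjXg.
Qed.

(** Reindexing of a product in a group that need not be abelian; it serves to permute the factors of
    [zeta_prod]. *)
Lemma prod_commute_perm (I : eqType) (F : I -> G) (r r' : seq I) :
  (forall i j, commute (F i) (F j)) -> perm_eq r r' ->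
  \prod_(i <- r) F i = \prod_(i <- r') F i.
Proof.
move=> FC; elim: r r' => [|i r IHr] r' rr'; first
  by move: rr'; rewrite perm_sym => /perm_nilP->.
have : i \in r' by rewrite -(perm_mem rr') mem_head.
move=> ir'; case/path.splitPr: r' / ir' rr' => p1 p2 rr'.
rewrite perm_sym -cat1s perm_catCA /= perm_cons perm_sym in rr'.
rewrite big_cons (IHr _ rr') !big_cat big_cons /= mulgA.
rewrite [F i * _]commute_prod; last by move=> j _; exact: FC.
by rewrite mulgA.
Qed.

End Expgz.

Lemma perm_map_fset_set (I : choiceType) (A : set I) (f : I -> I) :
  finite_set A -> injective f -> (forall x, A x -> A (f x)) ->
  perm_eq (map f (fset_set A)) (fset_set A).
Proof.
move=> finA f_inj fA; have fU : uniq (map f (fset_set A)) by rewrite map_inj_uniq.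
have sub : {subset map f (fset_set A) <= fset_set A}.
  by move=> _ /mapP[x + ->]; rewrite !in_fset_set // => /set_mem/fA/mem_set.
have [|_ e] := uniq_min_size fU sub; first by rewrite size_map.
exact: uniq_perm fU (fset_uniq _) e.
Qed.

(** * Triviality of powers in the spherical case *)

Section QuotientElements.
Variables (R : realType) (S : finType) (M : coxeter_matrix S).
Hypothesis M_spherical : spherical M.
Local Notation V := (root_space R S).
Local Notation rho w := (gl_fun (tits R (w : coxeter_group M))).
Local Notation Phi := (@cox_roots R S M).

Lemma finite_cox_roots : finite_set Phi.
Proof.
have -> : Phi = (fun ws => rho ws.1 (simple_root R ws.2)) @` [set: coxeter_group M * S].
  apply/seteqP; split=> [b [w [s ->]]|_ [[w s] _ <-]]; first by exists (w, s).
  by exists w, s.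
by apply: finite_image; rewrite -setXTT; apply: finite_setX.
Qed.

(** The default value 1 lies in PVA, so the commutation below holds for all vectors, as
    [prod_commute_perm] asks of every pair of indices. *)
Lemma zeta_nonroot (b : V) : ~ Phi b -> zeta M b = 1%g.
Proof.
by move=> nb; rewrite /zeta; case: xgetP => // z _ [w [s [E _]]]; case: nb; exists w, s.
Qed.

Lemma commute_zeta_bar (b c : V) n m :
  commute (expgz (zeta_bar M b) n) (expgz (zeta_bar M c) m).
Proof.
have zP (d : V) : nsg_set (PVA M) (zeta M d).
  have [/pi_P_zeta //|/zeta_nonroot/= ->] := pselect (Phi d).
  exact: gmulf1.
exact/commute_expgz/gcoset_derived_commute.
Qed.

Definition zeta_prod (f : V -> int) : va_quotient M :=
  (\prod_(b <- fset_set Phi) expgz (zeta_bar M b) (f b))%g.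

Lemma zeta_prodD f g : zeta_prod (f \+ g) = (zeta_prod f * zeta_prod g)%g.
Proof.
rewrite /zeta_prod -prodgM_commute => [|b c _ _]; last exact: commute_zeta_bar.
by apply: eq_bigr => b _; exact: expgzD.
Qed.

(** Conjugation by [w] permutes the [zeta] elements as [rho w] permutes the roots; reindexing by
    this permutation puts the inverse into the exponents. *)
Lemma zeta_prod_conj w f :
  (va_class (iota_W w) * zeta_prod f * (va_class (iota_W w))^-1 =
   zeta_prod (f \o rho w^-1%g))%g.
Proof.
set u := va_class (iota_W w).
have -> : (u * zeta_prod f * u^-1)%g = (zeta_prod f ^ u^-1)%g.
  by rewrite conjgE invgK mulgA.
rewrite conjg_prod /zeta_prod.
pose F b := expgz (zeta_bar M b) (f (rho w^-1%g b)).
rewrite -[RHS](@prod_commute_perm _ _ F (map (rho w) (fset_set Phi))).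
- rewrite big_map; apply: eq_big_seq => b; rewrite in_fset_set ?inE; last first.
    exact: finite_cox_roots.
  move=> /set_mem rb; rewrite /F titsK conjgE invgK mulgA conj_expgz /zeta_bar.
  by rewrite zeta_tits // !gmulfM gmulfV.
- by move=> b c; exact: commute_zeta_bar.
apply: perm_map_fset_set; [exact: finite_cox_roots|exact: can_inj (titsK w)|].
exact: cox_roots_tits.
Qed.

Lemma va_quotient_elt_expg (a : V -> int) (theta : coxeter_group M) k :
  (va_quotient_elt a theta ^+ k =
   zeta_prod (fun b => \sum_(i < k) a (rho (theta^-1 ^+ i)%g b)) *
   va_class (iota_W (theta ^+ k)))%g.
Proof.
elim: k => [|k IHk].
  rewrite !gmulf1 mulg1 /zeta_prod big1 // => b _.
  by rewrite big_ord0.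
rewrite expgS IHk /va_quotient_elt -/(zeta_prod a).
set u := va_class (iota_W theta).
have -> : va_class (iota_W (theta ^+ k.+1)%g) = (u * va_class (iota_W (theta ^+ k)))%g.
  by rewrite expgS !gmulfM.
(* Inserting [u^-1 * u] lets [u] pass the product as a conjugation. *)
rewrite mulgA -(mulgA _ u) -[(u * zeta_prod _)%g](mulgVK u) zeta_prod_conj.
rewrite !mulgA -zeta_prodD; congr (zeta_prod _ * _ * _)%g.
apply/funext => b /=; rewrite big_ord_recl tits1; congr (_ + _).
by apply: eq_bigr => i _; rewrite -titsM -expgSr.
Qed.

Lemma twisted_expgz (f : V -> int) n :
  expgz ((f, 1%g) : twisted V) n = (fun v => f v * n, 1%g).
Proof.
have E k : (((f, 1) : twisted V) ^+ k)%g = (fun v => f v * k%:Z, 1%g).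
  elim: k => [|k IHk]; first by congr pair; apply/funext => v; rewrite mulr0.
  rewrite expgS IHk; congr pair; last exact: mulg1.
  by apply/funext => v /=; rewrite invg1 gl_fun1 -addn1 PoszD mulrDr mulr1 addrC.
case: n => n /=; rewrite E //.
congr pair; last exact: invg1.
by apply/funext => v /=; rewrite gl_fun1 NegzE mulrN.
Qed.

Lemma linearize_zeta_prod (f : V -> int) (r : seq V) : {in r, forall b, Phi b} ->
  linearize R (\prod_(b <- r) expgz (zeta M b) (f b))%g =
  (fun v => \sum_(b <- r) (v == b)%:R * f b, 1%g).
Proof.
elim: r => [|b r IHr] rP.
  by rewrite big_nil gmulf1; congr pair; apply/funext => v; rewrite big_nil.
rewrite big_cons gmulfM /= IHr => [|c cr]; last by apply: rP; rewrite inE cr orbT.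
rewrite gmulf_expgz /= linearize_zeta; last by apply: rP; exact: mem_head.
rewrite twisted_expgz.
congr pair; last exact: mulg1.
by apply/funext => v /=; rewrite invg1 gl_fun1 big_cons.
Qed.

(** The formula for the power gives one direction. For the other, equality in the quotient is
    preserved by [pi_P], which detects [theta ^+ k], and by [linearize], which detects the
    exponents. *)
Lemma va_quotient_elt_expg_eq1 (a : V -> int) (theta : coxeter_group M) k :
  (va_quotient_elt a theta ^+ k = 1)%g <->
  (theta ^+ k = 1)%g /\
  forall b, Phi b -> \sum_(i < k) a (rho (theta^-1 ^+ i)%g b) = 0.
Proof.
split=> [|[thk a0]]; last first.
  rewrite va_quotient_elt_expg thk !gmulf1 mulg1 /zeta_prod big_seq big1 // => b.
  rewrite in_fset_set; last exact: finite_cox_roots.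
  by move=> /set_mem rb; rewrite a0.
pose x := ((\prod_(b <- fset_set Phi) expgz (zeta M b) (a b)) * iota_W theta)%g.
have -> : va_quotient_elt a theta = va_class x.
  rewrite /va_quotient_elt gmulfM; congr (_ * _)%g.
  by rewrite gmulf_prod; apply: eq_bigr => b _; rewrite gmulf_expgz.
have rP : {in fset_set Phi, forall b : V, Phi b}.
  by move=> b; rewrite in_fset_set; [move/set_mem|exact: finite_cox_roots].
have lx : linearize R x =
    (fun v => \sum_(b <- fset_set Phi) (v == b)%:R * a b, tits R theta).
  rewrite gmulfM /= linearize_iota linearize_zeta_prod //.
  by congr pair; [apply/funext => v /=; rewrite addr0 | exact: mul1g].
(* The function part vanishes off the roots while [a] is arbitrary there, so the two agree at roots
   only; this suffices because [theta] preserves roots. *)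
have lxa b : Phi b -> (linearize R x).1 b = a b.
  move=> rb; rewrite lx /= (bigD1_seq b) ?fset_uniq //=; last first.
    by rewrite in_fset_set; [exact/mem_set|exact: finite_cox_roots].
  rewrite eqxx mul1r big1 ?addr0 // => c nc.
  by rewrite eq_sym (negPf nc) mul0r.
move=> xk1; have xk : va_class (x ^+ k)%g = va_class 1%g by rewrite gmulfXn gmulf1.
have thk : (theta ^+ k = 1)%g.
  have := va_class_inj_pi_P xk; rewrite gmulf1 gmulfXn gmulfM /= pi_P_iota.
  suff -> : pi_P (\prod_(b <- fset_set Phi) expgz (zeta M b) (a b))%g = 1%g.
    by rewrite mul1g.
  rewrite gmulf_prod big_seq big1 // => b /rP rb.
  by rewrite gmulf_expgz /= pi_P_zeta //; case: (a b) => n /=; rewrite expg1n ?invg1.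
split=> // b rb; have := va_class_inj_linearize R xk.
rewrite gmulf1 gmulfXn => /(congr1 (fun y : twisted V => y.1 b)).
rewrite twisted_expr /= => E; rewrite -[RHS]E; apply: eq_bigr => i _.
have -> : gl_fun ((linearize R x).2^-1 ^+ i)%g b = rho (theta^-1 ^+ i)%g b.
  by rewrite lx gmulfXn gmulfV.
by rewrite lxa //; exact: cox_roots_tits.
Qed.

(** * Power exponents and orbit sums *)

Section Orbit.
Variables (theta : coxeter_group M) (c : V).
Hypothesis rc : Phi c.
Local Notation orbit := [set b | Phi b /\ zeta_orbit theta c (zeta M b)].

Lemma zeta_orbitE :
  orbit = [set b | exists n : int, b = rho (expgz theta n) c].
Proof.
apply/seteqP; split=> b /=.
  move=> [rb [n _ E]]; exists n; apply: (zeta_inj rb) (esym E).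
  exact: cox_roots_tits.
by move=> [n ->]; split; [exact: cox_roots_tits | exists n].
Qed.

(** The exponent of the [k]-th power is constant along the orbit. Summing it over the orbit and
    exchanging the sums gives the orbit sum [k] times. *)
Lemma orbit_sumE (a : V -> int) k : (theta ^+ k = 1)%g ->
  (\sum_(i < k) a (rho (theta^-1 ^+ i)%g c)) *+ size (fset_set orbit) =
  (\sum_(b \in orbit) a b) *+ k.
Proof.
move=> thk; have finO : finite_set orbit.
  by apply: sub_finite_set finite_cox_roots => b [].
have orbitM n b : orbit b -> orbit (rho (expgz theta n) b).
  rewrite zeta_orbitE => -[m ->]; exists (n + m); rewrite -titsM expgzD.
  by [].
pose F b := \sum_(i < k) a (rho (theta^-1 ^+ i)%g b).
(* The index shifts by one, and the term at [k] equals the term at 0 since [theta ^+ k = 1]; for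
   [k = 0] both sums are empty. *)
have FV b : F (rho theta^-1%g b) = F b.
  case: k thk @F => [|k] thk F; first by rewrite /F !big_ord0.
  rewrite /F big_ord_recr big_ord_recl /= tits1 addrC -titsM -expgSr expVgn thk.
  rewrite invg1 tits1; congr (_ + _); apply: eq_bigr => i _.
  by rewrite -titsM -expgSr.
have FVn n b : F (rho (theta^-1 ^+ n)%g b) = F b.
  by elim: n b => [|n IHn] b; rewrite ?tits1 // expgS titsM FV IHn.
have FO b : orbit b -> F b = F c.
  rewrite zeta_orbitE => -[[n|n] ->] /=; last by rewrite -expVgn FVn.
  by rewrite -[LHS](FVn n) -titsM expVgn mulVg tits1.
have inO b : b \in fset_set orbit -> orbit b by rewrite in_fset_set // => /set_mem.
transitivity (\sum_(b <- fset_set orbit) F b).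
  rewrite -/(F c) -iter_addr_0 -[size _]count_predT -big_const_seq.
  by apply: eq_big_seq => b /inO/FO.
rewrite exchange_big fsbig_finite //= -[k in RHS]card_ord -sumr_const.
(* For fixed [i] the map [theta^-i] permutes the orbit, so the inner sum is the orbit sum. *)
apply: eq_bigr => i _; rewrite -(big_map (rho (theta^-1 ^+ i)%g) xpredT a).
apply: perm_big; apply: perm_map_fset_set => //; first exact: can_inj (titsK _).
move=> b Ob; have := orbitM (- i%:Z) b Ob.
suff -> : expgz theta (- i%:Z) = (theta^-1 ^+ i)%g by [].
by rewrite expVgn; case: (i : nat) => [|n] /=; rewrite ?invg1.
Qed.

(** Both multipliers in [orbit_sumE] are positive, the orbit containing [c], and the integers have
    no torsion. *)
Lemma orbit_sum_eq0 (a : V -> int) k : (0 < k)%N -> (theta ^+ k = 1)%g ->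
  \sum_(i < k) a (rho (theta^-1 ^+ i)%g c) = 0 <-> \sum_(b \in orbit) a b = 0.
Proof.
move=> k_gt0 thk; have E := orbit_sumE a thk.
have size_gt0 : (0 < size (fset_set orbit))%N.
  rewrite -has_predT; apply/hasP; exists c => //.
  rewrite in_fset_set; last by apply: sub_finite_set finite_cox_roots => b [].
  by apply/mem_set; split=> //; exists 0; rewrite //= tits1.
by split=> F; move: E; rewrite F mul0rn => /eqP; [rewrite eq_sym|];
  rewrite mulrn_eq0 gtn_eqF // => /eqP.
Qed.

End Orbit.

Lemma va_quotient_elt_expg_eq1_orbit (a : V -> int) (theta : coxeter_group M) k :
  (0 < k)%N ->
  (va_quotient_elt a theta ^+ k = 1)%g <->
  (theta ^+ k = 1)%g /\ forall c, Phi c ->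
    \sum_(b \in [set b | Phi b /\ zeta_orbit theta c (zeta M b)]) a b = 0.
Proof.
move=> k_gt0; rewrite va_quotient_elt_expg_eq1; split=> -[thk a0]; split=> // c rc.
  exact/(orbit_sum_eq0 rc a k_gt0 thk)/a0.
exact/(orbit_sum_eq0 rc a k_gt0 thk)/a0.
Qed.

Lemma zeta_orbit_tits (theta : coxeter_group M) (c : V) n :
  zeta_orbit theta (rho (expgz theta n) c) = zeta_orbit theta c.
Proof.
apply/seteqP; split=> _ [m _ <-].
  by exists (m + n) => //; rewrite expgzD titsM.
by exists (m - n) => //; rewrite -titsM -expgzD subrK.
Qed.

End QuotientElements.

Theorem theorem3p3 (R : realType) (S : finType) (M : coxeter_matrix S)
    (M_spherical : spherical M)
    (a : root_space R S -> int) (theta : coxeter_group M)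
    (T : set (virtual_artin M)) (T_repr : orbit_representatives R theta T)
    (t : nat) :
  has_order (va_quotient_elt a theta) t <->
  has_order theta t /\
  forall c : root_space R S, cox_roots M c -> T (zeta M c) ->
    \sum_(b \in [set b | cox_roots M b /\ zeta_orbit theta c (zeta M b)]) a b = 0.
Proof.
have [TP Trepr] := T_repr.
pose sum0 (c : root_space R S) :=
  \sum_(b \in [set b | cox_roots M b /\ zeta_orbit theta c (zeta M b)]) a b = 0.
have sumT : (forall c, cox_roots M c -> T (zeta M c) -> sum0 c) ->
    forall c, cox_roots M c -> sum0 c.
  move=> T0 c rc; have [z [[Tz [n _ zE]] _]] := Trepr c rc.
  have := T0 _ (cox_roots_tits (expgz theta n) rc).
  by rewrite /sum0 zeta_orbit_tits zE; apply.
have wP k := @va_quotient_elt_expg_eq1_orbit _ _ _ M_spherical a theta k.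
(* The orbit condition does not involve the exponent: once it holds, the powers of the two elements
   are trivial for the same positive exponents, so the minimal ones agree. *)
split=> [[t0 /(wP _ t0)[tht a0] tmin]|[[t0 tht tmin] /sumT a0]].
  split; last by move=> c rc _; exact: a0.
  by split=> // k k0 thk; apply: tmin => //; apply/wP.
split=> //; first exact/wP.
by move=> k k0 /(wP _ k0)[thk _]; exact: tmin.
Qed.
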